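(* Let $m,n\ge 1$ be integers, let $1<p_{1},\dots,p_{m}<\infty$ and let $p$ be defined by $\frac{1}{p}=\sum_{i=1}^{m}\frac{1}{p_{i}}$. Then there exists a positive constant $C$ such that the following holds for every $m$-tuple $\vec{\omega}=(\omega_{1},\dots,\omega_{m})$ of arbitrary weights on $\mathbb{R}^n$ and every $m$-tuple $\vec f=(f_1,\dots,f_m)$ of locally integrable functions on $\mathbb{R}^n$ (so $C$ does not depend on the $\omega_j$ and $f_j$). Put $\nu_{\vec{\omega}}=\prod_{j=1}^{m}\omega_{j}^{p/p_{j}}$ and $W_{j}=M_{\mathcal{R}}M_{\mathcal{R}}^{n-1}\cdots M_{\mathcal{R}}^{1}\omega_{j}$ for $j=1,\dots,m$. Then $$\int_{\mathbb{R}^{n}}\big[\mathcal{M}_{\mathcal{R}}(\vec{f})(y)\big]^{p}\,\nu_{\vec{\omega}}(y)\,dy\leq C\prod_{j=1}^{m}\|f_{j}\|^{p}_{L^{p_{j}}(\mathbb{R}^{n},W_{j})}.$$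
   Context: A weight is a nonnegative locally integrable function on $\mathbb{R}^n$. For a $[0,\infty]$-valued measurable function $W$, $\|f\|_{L^{q}(\mathbb{R}^n,W)}=\left(\int_{\mathbb{R}^n}|f|^{q}W\,dx\right)^{1/q}$ (with $0\cdot\infty=0$). $\mathcal{R}$ is the family of all rectangles in $\mathbb{R}^n$ with sides parallel to the coordinate axes. The multilinear strong maximal function is $\mathcal{M}_{\mathcal{R}}(\vec{f})(x)=\sup_{R\in\mathcal{R},\,R\ni x}\prod_{j=1}^{m}\frac{1}{|R|}\int_{R}|f_{j}(y)|\,dy$. For $c=1,\dots,n$, $\mathcal{R}_{c}$ is the set of all rectangles in $\mathbb{R}^n$ with sides parallel to the coordinate axes and having complexity $c$, i.e. rectangles for which there are $\alpha_1,\dots,\alpha_c>0$ such that every side length is one of $\alpha_1,\dots,\alpha_c$, where $\alpha_1,\dots,\alpha_c$ vary over all positive numbers (a $c$-parameter family; $\mathcal{R}_1$ is the set of cubes and $\mathcal{R}_n=\mathcal{R}$). The strong maximal operator with complexity $c$ is $M_{\mathcal{R}}^{c}f(x)=\sup_{R\in\mathcal{R}_{c},\,R\ni x}\frac{1}{|R|}\int_{R}|f(y)|\,dy$, and $M_{\mathcal{R}}=M_{\mathcal{R}}^{n}$ is the strong maximal operator. These operators are applied to $[0,\infty]$-valued functions in the obvious way. In $W_j$ the operators $M_{\mathcal{R}}^{1},M_{\mathcal{R}}^{2},\dots,M_{\mathcal{R}}^{n-1},M_{\mathcal{R}}^{n}=M_{\mathcal{R}}$ are applied successively in this order to $\omega_j$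 (for $n=1$, $W_j=M_{\mathcal{R}}\omega_j$). *)

(* Defs.v *)
(* Written against MathComp and MathComp-Analysis. *)
From HB Require Import structures.
From mathcomp Require Import all_boot all_order all_algebra.
From mathcomp Require Import all_classical all_reals all_analysis.

Set Implicit Arguments.
Unset Strict Implicit.
Unset Printing Implicit Defensive.

Import Order.TTheory GRing.Theory Num.Theory.
Import numFieldNormedType.Exports.

Local Open Scope classical_set_scope.
Local Open Scope ring_scope.

(* Points of R^n are [n.-tuple R], which the library equips with the product
   (Borel) sigma-algebra; the library has no Lebesgue measure on R^n, so the
   n-fold product of [lebesgue_measure] is built here by recursion on n. *)

Section tuple_cons_measure.
Context {R : realType} {n : nat}.
Local Notation Tup k := (k.-tuple (measurableTypeR R)).

Definition tuple_of_pair (xt : measurableTypeR R * Tup n) : Tup n.+1 :=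
  [tuple of xt.1 :: xt.2].

Definition pair_of_tuple (t : Tup n.+1) : measurableTypeR R * Tup n :=
  (thead t, [tuple of behead t]).

Lemma measurable_tuple_of_pair : measurable_fun [set: _] tuple_of_pair.
Proof. exact: measurable_cons. Qed.

Lemma measurable_pair_of_tuple : measurable_fun [set: _] pair_of_tuple.
Proof.
apply/measurable_fun_pairP; split; first exact: measurable_tnth.
exact: measurable_behead.
Qed.

Lemma tuple_of_pairK : cancel tuple_of_pair pair_of_tuple.
Proof.
by move=> [x t]; rewrite /pair_of_tuple theadE; congr pair; exact: val_inj.
Qed.

Variable mu : {sigma_finite_measure set (Tup n) -> \bar R}.

Definition tuple_cons_measure : set (Tup n.+1) -> \bar R :=
  pushforward (lebesgue_measure \x mu)%E tuple_of_pair.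

Let tuple_cons_measure0 : tuple_cons_measure set0 = 0%E.
Proof. by rewrite /tuple_cons_measure /pushforward preimage_set0 measure0. Qed.

Let tuple_cons_measure_ge0 A : (0 <= tuple_cons_measure A)%E.
Proof. by rewrite /tuple_cons_measure /pushforward measure_ge0. Qed.

Let tuple_cons_measure_semi_sigma_additive :
  semi_sigma_additive tuple_cons_measure.
Proof.
move=> F mF tF mUF; rewrite /tuple_cons_measure /pushforward preimage_bigcup.
apply: measure_semi_sigma_additive.
- by move=> k; rewrite -[X in measurable X]setTI; exact: measurable_tuple_of_pair.
- apply/trivIsetP => /= i j _ _ ij; rewrite -preimage_setI.
  by move/trivIsetP : tF => /(_ _ _ _ _ ij) ->//; rewrite preimage_set0.
- rewrite -preimage_bigcup -[X in measurable X]setTI.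
  exact: measurable_tuple_of_pair.
Qed.

HB.instance Definition _ := isMeasure.Build _ _ _ tuple_cons_measure
  tuple_cons_measure0 tuple_cons_measure_ge0
  tuple_cons_measure_semi_sigma_additive.

Lemma tuple_cons_measure_sigma_finite : sigma_finite setT tuple_cons_measure.
Proof.
have /sigma_finiteP[F [FT ndF Foo]] := sigma_finiteT (@lebesgue_measure R).
have /sigma_finiteP[G [GT ndG Goo]] := sigma_finiteT mu.
exists (fun k => pair_of_tuple @^-1` (F k `*` G k)).
  apply/seteqP; split => // t _.
  have [k _ Fk] : (\bigcup_k F k) (thead t) by rewrite -FT.
  have [l _ Gl] : (\bigcup_k G k) [tuple of behead t] by rewrite -GT.
  exists (maxn k l) => //; split => /=.
  - by move: Fk; exact/subsetPset/ndF/leq_maxl.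
  - by move: Gl; exact/subsetPset/ndG/leq_maxr.
move=> k; have [mF Fk] := Foo k; have [mG Gk] := Goo k; split.
  rewrite -[Y in measurable Y]setTI.
  by apply: measurable_pair_of_tuple => //; exact: measurableX.
rewrite /tuple_cons_measure /pushforward -comp_preimage.
have -> : pair_of_tuple \o tuple_of_pair = id.
  by apply/funext => xt /=; rewrite tuple_of_pairK.
by rewrite preimage_id product_measure1E// lte_mul_pinfty// ge0_fin_numE.
Qed.

HB.instance Definition _ := @Measure_isSigmaFinite.Build _ _ _
  tuple_cons_measure tuple_cons_measure_sigma_finite.

End tuple_cons_measure.

Fixpoint borel_lebesgue {R : realType} (n : nat) :
    {sigma_finite_measure set (n.-tuple (measurableTypeR R)) -> \bar R} :=
  match n with
  | 0 => \d_[tuple]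
  | k.+1 => tuple_cons_measure (borel_lebesgue k)
  end.

(* R^n with the sigma-algebra of Lebesgue measurable sets, i.e. the completion
   of the Borel one, in its Caratheodory form. *)
Definition Rn (R : realType) (n : nat) : Type :=
  caratheodory_type ((borel_lebesgue n : {measure set _ -> \bar R})^*)%mu.
HB.instance Definition _ (R : realType) (n : nat) := Measurable.on (Rn R n).

Definition lebesgue (R : realType) (n : nat) : set (Rn R n) -> \bar R :=
  @completed_measure_extension _ _ _ (borel_lebesgue n).
HB.instance Definition _ (R : realType) (n : nat) :=
  Measure.on (@lebesgue R n).
Arguments lebesgue R n : clear implicits.

Section maximal_functions.
Context {R : realType} {n : nat}.
Implicit Types (f : Rn R n -> R) (g W : Rn R n -> \bar R) (Q : set (Rn R n)).
Local Notation mu := (lebesgue R n).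

Definition to_rV (x : Rn R n) : 'rV[R]_n :=
  \row_i tnth (x : n.-tuple R) i.

(* The topology of R^n is that of ['rV[R]_n]. *)
Definition locally_integrable_Rn f :=
  measurable_fun [set: Rn R n] f /\
  forall K : set (Rn R n), compact (to_rV @` K) ->
    (\int[mu]_(x in K) `|f x|%:E < +oo)%E.

Definition weight f := (forall x, 0 <= f x) /\ locally_integrable_Rn f.

Definition rectangle (a b : 'I_n -> R) : set (Rn R n) :=
  [set x | forall i, a i < tnth (x : n.-tuple R) i < b i].

Definition rectangles : set (set (Rn R n)) :=
  [set Q | exists a b : 'I_n -> R,
     (forall i, a i < b i) /\ Q = rectangle a b].

Definition rectangles_of_complexity (c : nat) : set (set (Rn R n)) :=
  [set Q | exists (a b : 'I_n -> R) (alpha : 'I_c -> R),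
     [/\ forall k, 0 < alpha k,
         forall i, exists k, b i - a i = alpha k &
         Q = rectangle a b]].

Definition average g Q : \bar R :=
  ((mu Q)^-1 * \int[mu]_(y in Q) `|g y|)%E.

Definition strong_maximal (c : nat) g (x : Rn R n) : \bar R :=
  ereal_sup [set average g Q | Q in rectangles_of_complexity c `&`
                                    [set Q | Q x]].

(* [iterated_maximal k g] is M^k (... (M^2 (M^1 g))). *)
Fixpoint iterated_maximal (k : nat) g : Rn R n -> \bar R :=
  match k with
  | 0 => g
  | j.+1 => strong_maximal j.+1 (iterated_maximal j g)
  end.

Definition multilinear_strong_maximal (m : nat) (f : 'I_m -> Rn R n -> R)
    (x : Rn R n) : \bar R :=
  ereal_sup [set (\prod_(j < m) average (EFin \o f j) Q)%E |
             Q in rectangles `&` [set Q | Q x]].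

Definition weighted_Lnorm (q : R) W f : \bar R :=
  ((\int[mu]_x ((`|f x| `^ q)%:E * W x)) `^ q^-1)%E.

End maximal_functions.

(* Main.v *)
(* Hölder's inequality reduces the theorem to the linear bounds
   \int (M_R f)^q w <= C \int |f|^q W with q = p_j.  By the one-third trick and
   Fatou's lemma M_R may be replaced by the maximal function over the dyadic
   rectangles of a finite grid, and f, w by their means over the cells.  There,
   peeling off the smallest side of a rectangle of sides 2^(k_i) shows that its
   average is at most
   F (S (... (S f))), with n - 1 operators S, where F is the maximal operator over
   dyadic cubes and S the supremum over subsets B of the directions of the
   one-parameter maximal operators M_B over rectangles of common side 2^m in the
   directions of B and of one cell in the others.  Each M_B is a martingale
   maximal operator, so \int (M_B g)^q v <= C \int g^q (M_B v) by Doob's weak type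
   bound and interpolation, and iterating gives the weight S (... (S (F w))).
   Finally F has complexity 1 and S complexity at most 2, whence
   S^(n-1) F w <= C M^n ... M^2 M^1 w pointwise. *)
Require Import Defs.
From mathcomp Require Import all_boot all_order all_algebra.
From mathcomp Require Import all_classical all_reals all_analysis.
From mathcomp Require Import measurable_realfun.
From mathcomp Require Import ring lra zify.
Import Order.TTheory GRing.Theory Num.Theory.
Import numFieldNormedType.Exports.
Local Open Scope classical_set_scope.
Local Open Scope ring_scope.

Set Implicit Arguments.
Unset Strict Implicit.
Unset Printing Implicit Defensive.

Section interpolation.
Context {R : realType}.
Implicit Types (a q u : R).

Lemma sum_geometric_below a u (J : nat) : 1 < a -> 0 <= u ->
  \sum_(j < J | a ^+ j < u) a ^+ j <= a / (a - 1) * u.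
Proof.
move=> a1 u0; have a10 : 0 < a - 1 by rewrite subr_gt0.
have a0 : 0 < a by exact: lt_trans a1.
elim: J => [|J IH].
  by rewrite big_ord0 mulr_ge0// divr_ge0// ltW.
rewrite big_mkcond big_ord_recr/= -big_mkcond/=.
case: ifPn => [aJu|_]; last by rewrite addr0.
have geo : (a - 1) * \sum_(j < J.+1) a ^+ j = a ^+ J.+1 - 1.
  by rewrite subrX1.
apply: (@le_trans _ _ (\sum_(j < J.+1) a ^+ j)).
  rewrite big_ord_recr/= lerD2r big_mkcond/=; apply: ler_sum => i _.
  by case: ifP => // _; rewrite exprn_ge0// ltW.
rewrite mulrAC ler_pdivlMr// mulrC geo exprS.
by rewrite lerBlDr (le_trans (ler_wpM2l (ltW a0) (ltW aJu)))// lerDl.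
Qed.

Lemma bracket_pow2 (c : R) (g : R) (J : nat) : 0 < c -> c < g -> g <= c * 2 ^+ J ->
  exists j : 'I_J, c * 2 ^+ j < g <= c * 2 ^+ j.+1.
Proof.
move=> c0 cg; elim: J => [|J IH]; first by rewrite expr0 mulr1 leNgt cg.
have [gJ _|gJ gJ1] := leP g (c * 2 ^+ J).
  by have [j jP] := IH gJ; exists (widen_ord (leqnSn J) j).
by exists ord_max; rewrite /= gJ.
Qed.

Lemma powR_subr1 q x : 1 < q -> 0 <= x -> x `^ q = x `^ (q - 1) * x.
Proof.
move=> q1 x0; rewrite -[X in _ `^ X = _](subrK 1 q) (@powRD _ _ (q - 1) 1) ?powRr1// subrK.
by rewrite gt_eqF// (lt_trans _ q1).
Qed.

Lemma powR_exprn a q (j : nat) : 0 <= a -> (a ^+ j) `^ q = (a `^ q) ^+ j.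
Proof.
move=> a0; elim: j => [|j IH]; first by rewrite !expr0 powR1.
by rewrite !exprS powRM ?exprn_ge0// IH.
Qed.

Definition interpolation_const q : R :=
  let a := 2 `^ (q - 1) in 2 `^ q * 2 * (a / (a - 1) * 2 `^ (q - 1)).

Lemma powR2_gt1 q : 1 < q -> 1 < 2 `^ (q - 1) :> R.
Proof.
move=> q1; suff : 1 `^ (q - 1) < 2 `^ (q - 1) :> R by rewrite powR1.
by apply: gt0_ltr_powR; rewrite ?subr_gt0 ?nnegrE ?ltr1n.
Qed.

Lemma interpolation_const_gt0 q : 1 < q -> 0 < interpolation_const q.
Proof.
move=> q1; rewrite /interpolation_const.
have a1 := powR2_gt1 q1.
by rewrite !mulr_gt0 ?invr_gt0 ?subr_gt0 ?powR_gt0.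
Qed.

(* Marcinkiewicz interpolation between the weak type (1,1) estimate, already
   applied to the truncation of f at height t / 2, and the trivial sup bound;
   the layer cake is discretized over the heights [t = c * 2 ^+ j]. *)
Lemma weak_truncated_strong (X : finType) (q : R) (f g v V : X -> R) :
  1 < q -> (forall x, 0 <= f x) -> (forall x, 0 <= g x) ->
  (forall x, 0 <= v x) -> (forall x, 0 <= V x) ->
  (forall t, 0 < t ->
    t * \sum_(x | t < g x) v x <= 2 * \sum_(x | t < 2 * f x) f x * V x) ->
  \sum_x g x `^ q * v x <= interpolation_const q * \sum_x f x `^ q * V x.
Proof.
move=> q1 f0 g0 v0 V0 weak.
have q0 : 0 < q by exact: lt_trans q1.
have e0 : 0 < q - 1 by rewrite subr_gt0.
pose c : R := (\big[Num.min/1]_(x | 0 < g x) g x) / 2.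
have m0 : 0 < \big[Num.min/1]_(x | 0 < g x) g x.
  by apply: lt_bigmin.
have c0 : 0 < c by rewrite divr_gt0.
have cg x : 0 < g x -> c < g x.
  move=> gx; have : \big[Num.min/1]_(x | 0 < g x) g x <= g x.
    exact: bigmin_le_cond.
  by apply: lt_le_trans; rewrite /c gtr_pMr// invf_lt1// ltr1n.
clearbody c.
have [J gJ] : exists J, forall x, g x <= c * 2 ^+ J.
  pose G := (\big[Num.max/0]_x g x) / c.
  have G0 : 0 <= G by apply: divr_ge0; [exact: bigmax_ge_id|exact: ltW].
  exists (Num.trunc G).+1 => x.
  have gG : g x / c <= G by rewrite ler_pM2r ?invr_gt0//; exact: le_bigmax.
  rewrite mulrC -ler_pdivrMr//; apply: (le_trans gG).
  by rewrite (le_trans (ltW (truncnS_gt G)))// -natrX ler_nat ltnW// ltn_expl.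
pose a : R := 2 `^ (q - 1).
have a1 : 1 < a by exact: powR2_gt1.
pose t (j : nat) := c * 2 ^+ j.
have t0 j : 0 < t j by rewrite mulr_gt0// exprn_gt0.
have tq j : t j `^ (q - 1) = c `^ (q - 1) * a ^+ j.
  by rewrite /t /a powRM ?exprn_ge0 ?(ltW c0)// powR_exprn.
have step1 x : g x `^ q <= 2 `^ q * \sum_(j < J | t j < g x) t j `^ q.
  have [gx0|gx0] := eqVneq (g x) 0.
    rewrite gx0 powR0 ?gt_eqF// mulr_ge0 ?powR_ge0// sumr_ge0// => i _.
    exact: powR_ge0.
  have gx : 0 < g x by rewrite lt_neqAle eq_sym gx0 g0.
  have [j /andP[jg gj]] := bracket_pow2 c0 (cg _ gx) (gJ x).
  rewrite (bigD1 j)//= mulrDr.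
  rewrite (le_trans (_ : _ <= 2 `^ q * t j `^ q)) ?lerDl//.
    have tj0 := ltW (t0 j); rewrite -powRM//.
    apply: ge0_ler_powR; rewrite ?nnegrE ?(ltW q0)//.
      by rewrite pmulr_rge0.
    by rewrite (le_trans gj)// /t mulrCA -exprS.
  by rewrite mulr_ge0 ?powR_ge0// sumr_ge0// => i _; exact: powR_ge0.
apply: (@le_trans _ _
   (\sum_x \sum_(j < J | t j < g x) 2 `^ q * t j `^ q * v x)).
  apply: ler_sum => x _; rewrite -mulr_suml -mulr_sumr.
  by rewrite ler_wpM2r.
rewrite (exchange_big_dep xpredT)//=.
apply: (@le_trans _ _ (\sum_(j < J) 2 `^ q * 2 * (t j `^ (q - 1) *
    \sum_(x | t j < 2 * f x) f x * V x))).
  apply: ler_sum => j _; rewrite -mulr_sumr -!mulrA ler_wpM2l ?powR_ge0//.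
  rewrite (mulrCA 2) (powR_subr1 q1 (ltW (t0 j))) -mulrA.
  by rewrite ler_wpM2l ?powR_ge0// weak.
rewrite -mulr_sumr /interpolation_const -[leRHS]mulrA ler_wpM2l ?mulr_ge0 ?powR_ge0//.
under [leLHS]eq_bigr do rewrite mulr_sumr.
rewrite (exchange_big_dep xpredT)//= mulr_sumr; apply: ler_sum => x _.
rewrite -mulr_suml.
rewrite (powR_subr1 q1 (f0 x)) !mulrA.
rewrite ler_wpM2r// ler_wpM2r// -mulrA -powRM//.
pose u := (2 * f x / c) `^ (q - 1).
have cu : c `^ (q - 1) * u = (2 * f x) `^ (q - 1).
  rewrite -powRM ?divr_ge0 ?mulr_ge0 ?(ltW c0)//.
  by rewrite mulrC divfK// gt_eqF.
rewrite -cu mulrCA.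
under eq_bigr do rewrite tq.
rewrite -mulr_sumr ler_wpM2l ?powR_ge0//.
apply: le_trans (sum_geometric_below J a1 (powR_ge0 _ _)).
rewrite le_eqVlt (eq_bigl (fun j : 'I_J => a ^+ j < u)) ?eqxx// => j.
have -> : a ^+ j = (2 ^+ j) `^ (q - 1).
  by rewrite /a powR_exprn.
have -> : (t j < 2 * f x) = (2 ^+ j < 2 * f x / c).
  by rewrite ltr_pdivlMr// /t (mulrC c).
have n1 : (2 : R) ^+ j \in Num.nneg by rewrite nnegrE exprn_ge0.
have n2 : 2 * f x / c \in Num.nneg by rewrite nnegrE divr_ge0 ?mulr_ge0 ?(ltW c0).
apply/idP/idP => [|h]; first by apply: gt0_ltr_powR.
rewrite ltNge; apply/negP => h2; move: h; apply/negP; rewrite -leNgt.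
by apply: ge0_ler_powR => //; exact: ltW.
Qed.


End interpolation.

Section nested_partitions.
Context {R : realType} {X : finType} (K : nat) (B : nat -> X -> {set X}).
Implicit Types (f v : X -> R) (A : {set X}).

Definition set_mean f A : R := (\sum_(y in A) f y) / #|A|%:R.

Lemma set_mean_ge0 f A : (forall x, 0 <= f x) -> 0 <= set_mean f A.
Proof. by move=> f0; rewrite divr_ge0// sumr_ge0. Qed.

Lemma ler_set_mean f v A :
  (forall x, f x <= v x) -> set_mean f A <= set_mean v A.
Proof.
by move=> fv; rewrite ler_wpM2r ?invr_ge0// ler_sum.
Qed.

Definition nested_maximal f (x : X) : R :=
  \big[Num.max/0]_(m < K.+1) set_mean f (B m x).

Lemma nested_maximal_ge0 f x : 0 <= nested_maximal f x.
Proof. exact: bigmax_ge_id. Qed.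

Lemma set_mean_le_nested_maximal f x m :
  (m <= K)%N -> set_mean f (B m x) <= nested_maximal f x.
Proof.
move=> mK.
exact: (le_bigmax _ (fun m : 'I_K.+1 => set_mean f (B m x)) (Ordinal (mK : (m < K.+1)%N))).
Qed.

Hypothesis mem_B : forall m x, x \in B m x.
Hypothesis B_class : forall m x y, y \in B m x -> B m y = B m x.
Hypothesis B_nested : forall m m' x, (m <= m' <= K)%N -> B m x \subset B m' x.

Lemma nested_maximal_weak f v t : 0 < t ->
  (forall x, 0 <= f x) -> (forall x, 0 <= v x) ->
  t * \sum_(x | t < nested_maximal f x) v x <=
    \sum_(x | t < nested_maximal f x) f x * nested_maximal v x.
Proof.
move=> t0 f0 v0; set U := fun x => t < nested_maximal f x.
have [lev levP] : exists lev : X -> nat, forall x, U x ->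
    [/\ (lev x <= K)%N, t < set_mean f (B (lev x) x) &
    forall m, (m <= K)%N -> t < set_mean f (B m x) -> (m <= lev x)%N].
  suff /choice[lev levP] : forall x, exists l, U x -> 
      [/\ (l <= K)%N, t < set_mean f (B l x) &
      forall m, (m <= K)%N -> t < set_mean f (B m x) -> (m <= l)%N].
    by exists lev.
  move=> x.
  have [Ux|_] := boolP (U x); last by exists 0%N.
  pose P m := (m <= K)%N && (t < set_mean f (B m x)).
  have exP : exists m, P m.
    case/bigmax_gtP: Ux => [|[m _ tm]]; first by rewrite ltNge (ltW t0).
    by exists m; rewrite /P tm andbT -ltnS.
  have bP m : P m -> (m <= K)%N by case/andP.
  case: (ex_maxnP exP bP) => l /andP[lK tl] lmax.
  by exists l => _; split => // m mK tm; apply: lmax; rewrite /P mK.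
have levB x y : U x -> y \in B (lev x) x ->
    U y /\ B (lev y) y = B (lev x) x.
  move=> Ux yx; have [lxK tx xmax] := levP _ Ux.
  have By := B_class yx.
  have Uy : U y.
    by rewrite /U (lt_le_trans tx)// -By set_mean_le_nested_maximal.
  have [lyK ty ymax] := levP _ Uy.
  have lxy : (lev x <= lev y)%N by rewrite ymax// By.
  have xy : x \in B (lev y) y.
    have sub : B (lev x) y \subset B (lev y) y by rewrite B_nested// lxy.
    by move/fintype.subsetP: sub; apply; rewrite By.
  have lyx : (lev y <= lev x)%N by rewrite xmax// (B_class xy).
  have -> : lev y = lev x by apply/eqP; rewrite eqn_leq lyx lxy.
  by split.
rewrite mulr_sumr.
apply: (@le_trans _ _ (\sum_(x | U x) \sum_(y in B (lev x) x)
    (v x * f y / #|B (lev x) x|%:R))).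
  apply: ler_sum => x Ux; rewrite -mulr_suml -mulr_sumr -mulrA mulrC.
  by rewrite ler_wpM2l//; have [_ /ltW] := levP _ Ux.
rewrite (exchange_big_dep U)/=; last by move=> x y Ux /(levB _ _ Ux)[].
apply: ler_sum => y Uy.
rewrite (eq_big (fun x => x \in B (lev y) y)
    (fun x => f y * (v x / #|B (lev y) y|%:R))); last 2 first.
- move=> x; apply/andP/idP => [[Ux yx]|xy].
    by have [_ ->] := levB _ _ Ux yx; exact: mem_B.
  by have [Ux ->] := levB _ _ Uy xy; split => //; exact: mem_B.
- move=> x /andP[Ux yx]; have [_ ->] := levB _ _ Ux yx.
  by rewrite mulrA (mulrC (f y)).
rewrite -mulr_sumr -mulr_suml ler_wpM2l// set_mean_le_nested_maximal//.
by have [] := levP _ Uy.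
Qed.

Lemma nested_maximal_strong (q : R) f v : 1 < q ->
  (forall x, 0 <= f x) -> (forall x, 0 <= v x) ->
  \sum_x nested_maximal f x `^ q * v x <=
  interpolation_const q * \sum_x f x `^ q * nested_maximal v x.
Proof.
move=> q1 f0 v0; apply: weak_truncated_strong => //.
- by move=> x; exact: nested_maximal_ge0.
- by move=> x; exact: nested_maximal_ge0.
move=> t t0; pose f' x := if t < 2 * f x then f x else 0.
have f'0 x : 0 <= f' x by rewrite /f'; case: ifP.
have t20 : 0 < t / 2 by rewrite divr_gt0.
have Mf x : t < nested_maximal f x -> t / 2 < nested_maximal f' x.
  case/bigmax_gtP => [|[m _ tm]]; first by rewrite ltNge (ltW t0).
  apply/bigmax_gtP; right; exists m => //.
  have ff' : set_mean f (B m x) <= set_mean f' (B m x) + t / 2.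
    have card_gt0 : 0 < #|B m x|%:R :> R.
      by rewrite ltr0n card_gt0; apply/set0Pn; exists x; exact: mem_B.
    rewrite /set_mean -[t / 2](mulfK (lt0r_neq0 card_gt0)) -mulrDl.
    rewrite ler_pM2r ?invr_gt0// mulr_natr -sumr_const -big_split/=.
    apply: ler_sum => y _; rewrite /f'.
    case: ifPn => [_|]; first by rewrite lerDl ltW.
    by rewrite -leNgt add0r ler_pdivlMr// mulrC.
  lra.
rewrite -[X in X * _ <= _](divfK (lt0r_neq0 (ltr0n R 2))) mulrAC mulrC.
rewrite ler_pM2l//.
apply: le_trans (le_trans (nested_maximal_weak t20 f'0 v0) _).
  rewrite ler_wpM2l ?(ltW t20)//.
  rewrite [leLHS]big_mkcond [leRHS]big_mkcond/=; apply: ler_sum => x _.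
  by case: ifP => [/Mf ->//|_]; case: ifP.
rewrite [leLHS]big_mkcond [leRHS]big_mkcond/=.
apply: ler_sum => x _; rewrite /f'.
by case: ifP; case: ifP; rewrite ?mul0r ?mulr_ge0 ?nested_maximal_ge0.
Qed.

End nested_partitions.

Section dyadic_blocks.
Context {R : realType} {n K : nat}.
Local Notation X := {ffun 'I_n -> 'I_(2 ^ K)}.
Implicit Types (k l : 'I_n -> nat) (f v w : X -> R) (x y z : X).

Definition dyadic_block k x : {set X} :=
  [set y : X | [forall i, (y i %/ 2 ^ k i == x i %/ 2 ^ k i)%N]].

Lemma card_dyadic_interval (a : nat) (x : 'I_(2 ^ K)) : (a <= K)%N ->
  #|[pred y : 'I_(2 ^ K) | (y %/ 2 ^ a == x %/ 2 ^ a)%N]| = (2 ^ a)%N.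
Proof.
move=> aK; have a0 : (0 < 2 ^ a)%N by rewrite expn_gt0.
have lt (j : 'I_(2 ^ a)) : (x %/ 2 ^ a * 2 ^ a + j < 2 ^ K)%N.
  have : (x %/ 2 ^ a < 2 ^ (K - a))%N by rewrite ltn_divLR// -expnD subnK.
  rewrite -(leq_pmul2r a0) -expnD subnK// mulSn addnC; apply: leq_trans.
  by rewrite ltn_add2l.
pose g (j : 'I_(2 ^ a)) : 'I_(2 ^ K) := Ordinal (lt j).
have g_inj : injective g.
  by move=> i j /(congr1 val)/= /addnI ij; exact: val_inj.
rewrite -[RHS](card_ord (2 ^ a)) -(card_codom g_inj); apply: eq_card => y.
rewrite !inE; apply/eqP/codomP => [yx|[j ->]].
  exists (Ordinal (ltn_pmod y a0)); apply: val_inj => /=.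
  by rewrite -yx -divn_eq.
by rewrite /g/= divnMDl// (divn_small (ltn_ord j)) addn0.
Qed.

Lemma divn_expn_le (a b y x : nat) : (a <= b)%N ->
  (y %/ 2 ^ a = x %/ 2 ^ a -> y %/ 2 ^ b = x %/ 2 ^ b)%N.
Proof. by move=> ab e; rewrite -(subnKC ab) expnD !divnMA e. Qed.

Lemma card_dyadic_interval2 (a b : nat) (x z : 'I_(2 ^ K)) :
  (a <= K)%N -> (b <= K)%N ->
  #|[pred y : 'I_(2 ^ K) | (y %/ 2 ^ a == x %/ 2 ^ a)%N &&
                           (y %/ 2 ^ b == z %/ 2 ^ b)%N]| =
  ((x %/ 2 ^ maxn a b == z %/ 2 ^ maxn a b) * 2 ^ minn a b)%N.
Proof.
wlog ab : a b x z / (a <= b)%N.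
  move=> h; have /orP[ab|ba] := leq_total a b => aK bK.
    exact: h.
  move/maxn_idPl: (ba) => ->; move/minn_idPr: (ba) => ->.
  rewrite eq_sym; have := h _ _ z x ba bK aK.
  move/maxn_idPr: (ba) => ->; move/minn_idPl: (ba) => -> <-.
  by apply: eq_card => y; rewrite !inE andbC.
move=> aK bK; move/maxn_idPr: (ab) => ->; move/minn_idPl: (ab) => ->.
have [xz|xz] := eqVneq (x %/ 2 ^ b)%N (z %/ 2 ^ b)%N; last first.
  rewrite mul0n; apply: eq_card0 => y; rewrite !inE.
  apply/negP => /andP[/eqP/(divn_expn_le ab) yx /eqP yz].
  by move: xz; rewrite -yx yz eqxx.
rewrite mul1n -[RHS](card_dyadic_interval x aK); apply: eq_card => y.
rewrite !inE; apply/andP/idP => [[]//|yx]; split => //.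
by rewrite -xz; apply/eqP/(divn_expn_le ab)/eqP.
Qed.

Lemma mem_dyadic_block k x : x \in dyadic_block k x.
Proof. by rewrite inE; apply/forallP. Qed.

Lemma dyadic_block_sym k x y : (y \in dyadic_block k x) = (x \in dyadic_block k y).
Proof. by rewrite !inE; apply: eq_forallb => i; rewrite eq_sym. Qed.

Lemma dyadic_block_class k x y :
  y \in dyadic_block k x -> dyadic_block k y = dyadic_block k x.
Proof.
rewrite inE => /forallP yx; apply/setP => z; rewrite !inE.
by apply: eq_forallb => i; rewrite (eqP (yx i)).
Qed.

Lemma dyadic_block_sub k l x :
  (forall i, k i <= l i)%N -> dyadic_block k x \subset dyadic_block l x.
Proof.
move=> kl; apply/fintype.subsetP => y; rewrite !inE => /forallP yx.
by apply/forallP => i; apply/eqP/(divn_expn_le (kl i))/eqP.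
Qed.

Lemma card_dyadic_blockI k l x z :
  (forall i, k i <= K)%N -> (forall i, l i <= K)%N ->
  #|dyadic_block k x :&: dyadic_block l z| =
  ((z \in dyadic_block (fun i => maxn (k i) (l i)) x) *
   \prod_i 2 ^ minn (k i) (l i))%N.
Proof.
move=> kK lK.
pose F i := [pred y : 'I_(2 ^ K) | (y %/ 2 ^ k i == x i %/ 2 ^ k i)%N &&
                           (y %/ 2 ^ l i == z i %/ 2 ^ l i)%N].
have -> : #|dyadic_block k x :&: dyadic_block l z| = #|family F|.
  apply: eq_card => y; rewrite !inE; apply/andP/familyP => [[]|yF].
    by move=> /forallP yx /forallP yz i; rewrite inE yx yz.
  by split; apply/forallP => i; move: (yF i); rewrite inE => /andP[].
rewrite card_family foldrE big_image/=.
under eq_bigr do rewrite card_dyadic_interval2//.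
rewrite big_split/=; congr muln; rewrite dyadic_block_sym inE.
case: (boolP [forall i : 'I_n, (x i %/ 2 ^ maxn (k i) (l i) ==
    z i %/ 2 ^ maxn (k i) (l i))%N]) => [/forallP xz|/forallPn[i xz]].
  by rewrite big1// => i _; rewrite xz.
by rewrite (bigD1 i)//= (negbTE xz).
Qed.

Lemma card_dyadic_block k x : (forall i, k i <= K)%N ->
  #|dyadic_block k x| = (\prod_i 2 ^ k i)%N.
Proof.
move=> kK; rewrite -[dyadic_block k x]finset.setIid card_dyadic_blockI//.
rewrite mem_dyadic_block mul1n.
by apply: eq_bigr => i _; rewrite minnn.
Qed.

Definition dyadic_mean k f x : R := set_mean f (dyadic_block k x).

Lemma ler_dyadic_mean k f v x :
  (forall x, f x <= v x) -> dyadic_mean k f x <= dyadic_mean k v x.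
Proof. exact: ler_set_mean. Qed.

Lemma dyadic_mean0 f x : dyadic_mean (fun=> 0%N) f x = f x.
Proof.
have E : dyadic_block (fun=> 0%N) x = [set x]%SET.
  apply/setP => y; rewrite !inE; apply/forallP/eqP => [yx|-> //].
  by apply/ffunP => i; apply: val_inj; move/eqP: (yx i); rewrite expn0 !divn1.
by rewrite /dyadic_mean /set_mean E big_set1 cards1 divr1.
Qed.

Lemma dyadic_mean_comp k l f x :
  (forall i, k i <= K)%N -> (forall i, l i <= K)%N ->
  dyadic_mean (fun i => maxn (k i) (l i)) f x =
  dyadic_mean k (dyadic_mean l f) x.
Proof.
move=> kK lK; rewrite /dyadic_mean /set_mean.
have mK i : (maxn (k i) (l i) <= K)%N by rewrite geq_max kK lK.
under [in RHS]eq_bigr do rewrite card_dyadic_block//.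
rewrite !card_dyadic_block// -mulr_suml (exchange_big_dep xpredT)//=.
set m := fun i => maxn (k i) (l i).
have -> : \sum_z \sum_(y in dyadic_block k x | z \in dyadic_block l y) f z =
    (\sum_(z in dyadic_block m x) f z) * (\prod_i 2 ^ minn (k i) (l i))%:R.
  rewrite mulr_suml [RHS]big_mkcond/=; apply: eq_bigr => z _.
  rewrite sumr_const (_ : #|_| = #|dyadic_block k x :&: dyadic_block l z|).
    rewrite card_dyadic_blockI//; case: ifP => _; first by rewrite mul1n mulr_natr.
    by rewrite mul0n mulr0n.
  by apply: eq_card => y; rewrite [RHS]finset.in_setI (dyadic_block_sym l z y).
rewrite -!mulrA; congr (_ * _).
rewrite -invfM -natrM.
set p := (\prod_i 2 ^ minn _ _)%N.
have -> : (\prod_i 2 ^ l i * \prod_i 2 ^ k i = p * \prod_i 2 ^ m i)%N.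
  rewrite /p -!big_split/=; apply: eq_bigr => i _.
  by rewrite -!expnD addnC addn_min_max.
have p0 : p%:R != 0 :> R.
  by rewrite pnatr_eq0 -lt0n prodn_gt0// => i; rewrite expn_gt0.
by rewrite natrM invfM mulrA divff// mul1r.
Qed.

End dyadic_blocks.

Section dyadic_maximal.
Context {R : realType} {n K : nat}.
Local Notation X := {ffun 'I_n -> 'I_(2 ^ K)}.
Implicit Types (k l : 'I_n -> nat) (f v w : X -> R) (x y z : X) (A : {set 'I_n}).

Definition level_on A (m : nat) : 'I_n -> nat := fun i => if i \in A then m else 0%N.

Lemma level_on_le A m i : (m <= K)%N -> (level_on A m i <= K)%N.
Proof. by rewrite /level_on; case: ifP. Qed.

(* For fixed [A] the blocks of sides [2 ^ m] in the directions of [A] and one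
   cell in the others form a one-parameter family. *)
Definition directional_maximal A f : X -> R :=
  nested_maximal K (fun m => dyadic_block (level_on A m)) f.

Definition sup_directional_maximal f x : R :=
  \big[Num.max/0]_(A : {set 'I_n}) directional_maximal A f x.

Definition cubic_maximal f : X -> R := directional_maximal [set: 'I_n]%SET f.

Lemma sup_directional_maximal_ge0 f x : 0 <= sup_directional_maximal f x.
Proof. exact: bigmax_ge_id. Qed.

Lemma cubic_maximal_ge0 f x : 0 <= cubic_maximal f x.
Proof. exact: nested_maximal_ge0. Qed.

Lemma iter_sup_directional_ge0 j f x : (forall x, 0 <= f x) ->
  0 <= iter j sup_directional_maximal f x.
Proof. by case: j => [|j] f0 //; exact: sup_directional_maximal_ge0. Qed.

Lemma directional_maximal_le_sup A f x :
  directional_maximal A f x <= sup_directional_maximal f x.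
Proof. exact: (le_bigmax _ (fun A => directional_maximal A f x)). Qed.

Lemma dyadic_mean_le_directional A m f x : (m <= K)%N ->
  dyadic_mean (level_on A m) f x <= directional_maximal A f x.
Proof.
exact: (@set_mean_le_nested_maximal _ _ K (fun m => dyadic_block (level_on A m))).
Qed.

Lemma directional_maximal_strong A (q : R) f v : 1 < q ->
  (forall x, 0 <= f x) -> (forall x, 0 <= v x) ->
  \sum_x directional_maximal A f x `^ q * v x <=
  interpolation_const q * \sum_x f x `^ q * directional_maximal A v x.
Proof.
move=> q1 f0 v0; apply: nested_maximal_strong => //.
- by move=> m x; exact: mem_dyadic_block.
- by move=> m x y; exact: dyadic_block_class.
- move=> m m' x /andP[mm' _]; apply: dyadic_block_sub => i.
  by rewrite /level_on; case: ifP.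
Qed.

Lemma sup_directional_maximal_strong (q : R) f v : 1 < q ->
  (forall x, 0 <= f x) -> (forall x, 0 <= v x) ->
  \sum_x sup_directional_maximal f x `^ q * v x <=
  #|{set 'I_n}|%:R * interpolation_const q *
    \sum_x f x `^ q * sup_directional_maximal v x.
Proof.
move=> q1 f0 v0.
apply: (@le_trans _ _
    (\sum_x \sum_(A : {set 'I_n}) directional_maximal A f x `^ q * v x)).
  apply: ler_sum => x _; rewrite -mulr_suml ler_wpM2r// /sup_directional_maximal.
  have [|A _ ->] := @eq_bigmax _ _ _ (0 : R) finset.set0 xpredT
      (fun A => directional_maximal A f x) isT.
    by move=> A _; exact: nested_maximal_ge0.
  by rewrite (bigD1 A)//= lerDl sumr_ge0// => B _; exact: powR_ge0.
rewrite exchange_big/= -mulrA mulr_natl -sumr_const.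
apply: ler_sum => A _; apply: le_trans (directional_maximal_strong A q1 f0 v0) _.
rewrite ler_wpM2l ?(ltW (interpolation_const_gt0 q1))//; apply: ler_sum => x _.
by rewrite ler_wpM2l ?powR_ge0 ?directional_maximal_le_sup.
Qed.

Lemma iter_sup_directional_strong (q : R) j f v : 1 < q ->
  (forall x, 0 <= f x) -> (forall x, 0 <= v x) ->
  \sum_x iter j sup_directional_maximal f x `^ q * v x <=
  (#|{set 'I_n}|%:R * interpolation_const q) ^+ j *
    \sum_x f x `^ q * iter j sup_directional_maximal v x.
Proof.
move=> q1 f0; elim: j v => [|j IH] v v0; first by rewrite mul1r.
rewrite [iter j.+1 _ v]iterSr /=.
have fj0 x := iter_sup_directional_ge0 j x f0.
apply: le_trans (sup_directional_maximal_strong q1 fj0 v0) _.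
rewrite exprS -[leRHS]mulrA.
rewrite ler_wpM2l ?(mulr_ge0 (ler0n _ _) (ltW (interpolation_const_gt0 q1)))//.
apply: IH => x; exact: sup_directional_maximal_ge0.
Qed.

(* Peel the smallest side [m] of a block supported in the directions of [A]:
   the block is an [m]-cube in these directions averaged with a block having
   one direction less. *)
Lemma dyadic_mean_peel A k j : #|A| = j.+1 -> (forall i, k i <= K)%N ->
  (forall i, i \notin A -> k i = 0%N) ->
  exists m l (A' : {set 'I_n}), [/\ (m <= K)%N, #|A'| = j,
    (forall i, l i <= K)%N, (forall i, i \notin A' -> l i = 0%N) &
    forall f x, dyadic_mean k f x = dyadic_mean (level_on A m) (dyadic_mean l f) x].
Proof.
move=> Aj kK kA; have [i0 i0A] : exists i0, i0 \in A.
  by apply/set0Pn; rewrite -card_gt0 Aj.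
case: (@arg_minnP _ i0 (mem A) k i0A) => i iA imin.
have {}iA : i \in A := iA.
pose l := fun i' => if i' \in (A :\ i)%SET then k i' else 0%N.
have lK i' : (l i' <= K)%N by rewrite /l; case: ifP.
exists (k i), l, (A :\ i)%SET; split => //.
- by move: Aj; rewrite (cardsD1 i) iA => -[].
- by move=> i' /negbTE i'A; rewrite /l i'A.
move=> f x; rewrite -dyadic_mean_comp//; last first.
  by move=> i'; exact: level_on_le.
congr dyadic_mean; apply/funext => i'; rewrite /level_on /l !inE.
have [->|i'i] := eqVneq i' i; first by rewrite iA/= maxn0.
have [i'A|/kA ->//] := boolP (i' \in A).
by apply/esym/maxn_idPr; exact: imin.
Qed.

Lemma dyadic_mean_le_iter j A k f x : (forall x, 0 <= f x) ->
  #|A| = j -> (forall i, k i <= K)%N ->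
  (forall i, i \notin A -> k i = 0%N) ->
  dyadic_mean k f x <= iter j sup_directional_maximal f x.
Proof.
move=> f0; elim: j A k x => [|j IH] A k x Aj kK kA.
  rewrite (_ : k = fun=> 0%N) ?dyadic_mean0//; apply/funext => i.
  by apply: kA; rewrite (cards0_eq Aj) inE.
have [m [l [A' [mK A'j lK lA' ->]]]] := dyadic_mean_peel Aj kK kA.
rewrite /=; apply: le_trans (directional_maximal_le_sup A _ _).
apply: le_trans (dyadic_mean_le_directional _ _ _ mK).
by apply: ler_dyadic_mean => y; exact: IH A'j lK lA'.
Qed.

Definition dyadic_strong_maximal f x : R :=
  \big[Num.max/0]_(k : {ffun 'I_n -> 'I_K.+1}) dyadic_mean (fun i => k i) f x.

Lemma dyadic_strong_maximal_ge0 f x : 0 <= dyadic_strong_maximal f x.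
Proof. exact: bigmax_ge_id. Qed.

Lemma dyadic_mean_le_strong_maximal k f x : (forall i, k i <= K)%N ->
  dyadic_mean k f x <= dyadic_strong_maximal f x.
Proof.
move=> kK; pose k' := [ffun i => Ordinal (kK i : (k i < K.+1)%N)].
have -> : k = fun i => k' i by apply/funext => i; rewrite ffunE.
exact: (le_bigmax _ (fun k : {ffun 'I_n -> 'I_K.+1} => dyadic_mean (fun i => k i) f x)).
Qed.

Lemma dyadic_strong_maximal_le f x : (0 < n)%N -> (forall x, 0 <= f x) ->
  dyadic_strong_maximal f x <=
  cubic_maximal (iter n.-1 sup_directional_maximal f) x.
Proof.
move=> n0 f0; apply: bigmax_le => [|k _]; first exact: cubic_maximal_ge0.
have kK i : (k i <= K)%N by rewrite -ltnS.
have [||m [l [A' [mK A'j lK lA' ->]]]] := @dyadic_mean_peel [set: 'I_n]%SET _ n.-1 _ kK.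
- by rewrite cardsT card_ord prednK.
- by move=> i; rewrite inE.
apply: le_trans (dyadic_mean_le_directional _ _ _ mK).
by apply: ler_dyadic_mean => y; exact: dyadic_mean_le_iter A'j lK lA'.
Qed.

Definition dyadic_const (q : R) : R :=
  interpolation_const q * (#|{set 'I_n}|%:R * interpolation_const q) ^+ n.-1.

Lemma dyadic_strong_maximal_strong (q : R) f w : (0 < n)%N -> 1 < q ->
  (forall x, 0 <= f x) -> (forall x, 0 <= w x) ->
  \sum_x dyadic_strong_maximal f x `^ q * w x <=
  dyadic_const q *
    \sum_x f x `^ q * iter n.-1 sup_directional_maximal (cubic_maximal w) x.
Proof.
move=> n0 q1 f0 w0.
have fn0 x := iter_sup_directional_ge0 n.-1 x f0.
apply: (@le_trans _ _ (\sum_x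
  cubic_maximal (iter n.-1 sup_directional_maximal f) x `^ q * w x)).
  apply: ler_sum => x _; rewrite ler_wpM2r//.
  apply: ge0_ler_powR; rewrite ?nnegrE ?dyadic_strong_maximal_ge0 ?cubic_maximal_ge0//.
    by rewrite ltW// (lt_trans _ q1).
  exact: dyadic_strong_maximal_le.
apply: le_trans (directional_maximal_strong _ q1 fn0 w0) _.
rewrite /dyadic_const -mulrA ler_wpM2l ?(ltW (interpolation_const_gt0 q1))//.
by apply: iter_sup_directional_strong => // x; exact: cubic_maximal_ge0.
Qed.

End dyadic_maximal.

Section product_sets.
Context {R : realType}.
Local Notation Tup k := (k.-tuple (measurableTypeR R)).

Definition product_set n (A : 'I_n -> set R) : set (Tup n) :=
  [set x | forall i, A i (tnth x i)].

Lemma measurable_product_set n (A : 'I_n -> set R) :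
  (forall i, measurable (A i)) -> measurable (product_set A).
Proof.
move=> mA; rewrite (_ : product_set A =
    \bigcap_(i in [set: 'I_n]) (fun x : Tup n => tnth x i) @^-1` A i).
  apply: fin_bigcap_measurable => // i _; rewrite -[X in measurable X]setTI.
  exact: (measurable_tnth i measurableT (mA i)).
by apply/seteqP; split => [x Ax i _|x Ax i]; exact: Ax.
Qed.

Lemma borel_lebesgue_product_set n (A : 'I_n -> set R) :
  (forall i, measurable (A i)) ->
  borel_lebesgue n (product_set A) = (\prod_(i < n) lebesgue_measure (A i))%E.
Proof.
elim: n A => [|n IH] A mA.
  by rewrite big_ord0 /= diracE mem_set// => -[].
rewrite big_ord_recl /= /tuple_cons_measure /pushforward.
have -> : tuple_of_pair @^-1` product_set A =
    A ord0 `*` product_set (fun i => A (lift ord0 i)).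
  apply/seteqP; split => [[x t] /= At|[x t] /= [A0 At] i].
    split => /=; first exact: (At ord0).
    by move=> i; have := At (lift ord0 i); rewrite tnthS.
  by have [j ->|->] := unliftP ord0 i; [rewrite tnthS; exact: At|exact: A0].
rewrite product_measure1E; [|exact: mA|exact: measurable_product_set].
by rewrite IH.
Qed.

Lemma borel_measurable_Rn n (A : set (Tup n)) :
  measurable A -> measurable (A : set (Rn R n)).
Proof. by move=> mA; exact: caratheodory_measurable_mu_ext. Qed.

Lemma lebesgue_product_set n (A : 'I_n -> set R) :
  (forall i, measurable (A i)) ->
  lebesgue R n (product_set A) = (\prod_(i < n) lebesgue_measure (A i))%E.
Proof.
move=> mA; rewrite -borel_lebesgue_product_set//.
by apply: measurable_mu_extE; exact: measurable_product_set.
Qed.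

Lemma lebesgue_rectangle n (a b : 'I_n -> R) : (forall i, a i <= b i) ->
  lebesgue R n (rectangle a b) = (\prod_i (b i - a i))%:E.
Proof.
move=> ab; rewrite (_ : rectangle a b = product_set (fun i => `]a i, b i[%classic)).
  rewrite lebesgue_product_set// -prodEFin; apply: eq_bigr => i _.
  by rewrite lebesgue_measure_itv/= lte_fin; case: ltgtP (ab i) => // -> _; rewrite subrr.
by apply/seteqP; split => x xab i; move: (xab i); rewrite /= in_itv.
Qed.

Definition half_open_box n (a b : 'I_n -> R) : set (Rn R n) :=
  [set x | forall i, a i <= tnth (x : n.-tuple R) i < b i].

Lemma measurable_half_open_box n (a b : 'I_n -> R) : measurable (half_open_box a b).
Proof.
rewrite (_ : half_open_box a b = product_set (fun i => `[a i, b i[%classic)).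
  by apply: borel_measurable_Rn; apply: measurable_product_set.
by apply/seteqP; split => x xab i; move: (xab i); rewrite /= in_itv.
Qed.

Lemma lebesgue_half_open_box n (a b : 'I_n -> R) : (forall i, a i <= b i) ->
  lebesgue R n (half_open_box a b) = (\prod_i (b i - a i))%:E.
Proof.
move=> ab; rewrite (_ : half_open_box a b = product_set (fun i => `[a i, b i[%classic)).
  rewrite lebesgue_product_set// -prodEFin; apply: eq_bigr => i _.
  by rewrite lebesgue_measure_itv/= lte_fin; case: ltgtP (ab i) => // -> _; rewrite subrr.
by apply/seteqP; split => x xab i; move: (xab i); rewrite /= in_itv.
Qed.

Lemma compact_closed_box n (a b : 'I_n -> R) :
  compact (to_rV @` [set x : Rn R n | forall i, a i <= tnth (x : n.-tuple R) i <= b i]).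
Proof.
rewrite (_ : _ @` _ = [set v : 'rV[R]_n | forall i, `[a i, b i]%classic (v ord0 i)]).
  exact: (rV_compact (fun i => @segment_compact R (a i) (b i))).
apply/seteqP; split => [_ [x xab <-] i|v vab] /=.
  by rewrite mxE in_itv /=.
exists [tuple v ord0 i | i < n].
  by move=> i; rewrite tnth_mktuple; move: (vab i); rewrite /= in_itv.
by apply/rowP => i; rewrite mxE tnth_mktuple.
Qed.

End product_sets.

Section integral_monotonicity.
Context d (T : measurableType d) (R : realType) (mu : {measure set T -> \bar R}).
Implicit Types (f g : T -> \bar R) (D : set T).
Local Open Scope ereal_scope.

Lemma ge0_le_integralT f g : (forall x, 0 <= f x) -> (forall x, f x <= g x) ->
  \int[mu]_x f x <= \int[mu]_x g x.
Proof.
move=> f0 fg; have g0 x : 0 <= g x by exact: le_trans (fg x).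
rewrite !ge0_integralTE//; apply: le_ereal_sup => _ [h hf <-].
by exists h => // x; exact: le_trans (fg x).
Qed.

Lemma ge0_le_integral_subset D D' f g : (forall x, 0 <= f x) -> (forall x, 0 <= g x) ->
  D `<=` D' -> (forall x, D x -> f x <= g x) ->
  \int[mu]_(x in D) f x <= \int[mu]_(x in D') g x.
Proof.
move=> f0 g0 DD' fg; rewrite integral_mkcond [leRHS]integral_mkcond.
apply: ge0_le_integralT => x; rewrite !patchE; case: ifPn => //.
  move=> xD; have := set_mem xD => Dx.
  by rewrite mem_set ?fg//; exact: DD'.
by move=> _; case: ifP.
Qed.

Lemma measurable_fun_abs D (f : T -> R) :
  measurable_fun D f -> measurable_fun D (fun x => `|f x|)%R.
Proof. by move=> mf; exact: measurableT_comp. Qed.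

Lemma measurable_fun_abs_EFin D (f : T -> R) :
  measurable_fun D f -> measurable_fun D (fun x => `|f x|%:E).
Proof. by move=> mf; apply/measurable_EFinP; exact: measurable_fun_abs. Qed.

Lemma measurable_fun_powR D (f : T -> R) (q : R) :
  measurable_fun D f -> measurable_fun D (fun x => f x `^ q)%R.
Proof. by move=> mf; exact: (measurableT_comp (measurable_powR _)). Qed.

End integral_monotonicity.

Section grid.
Context {R : realType} {n K : nat} (A : 'I_n -> R) (h : R).
Hypothesis h_gt0 : 0 < h.
Local Notation X := {ffun 'I_n -> 'I_(2 ^ K)}.
Local Notation mu := (lebesgue R n).
Implicit Types (x y : X) (z : Rn R n) (S : {set X}) (c v : X -> R).

Definition cell x : set (Rn R n) :=
  half_open_box (fun i => A i + (x i)%:R * h) (fun i => A i + (x i).+1%:R * h).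

Lemma measurable_cell x : measurable (cell x).
Proof. exact: measurable_half_open_box. Qed.

Lemma lebesgue_cell x : mu (cell x) = (h ^+ n)%:E.
Proof.
rewrite lebesgue_half_open_box => [|i]; last first.
  by rewrite lerD2l ler_wpM2r ?ler_nat// ltW.
rewrite (eq_bigr (fun=> h)) ?prodr_const ?card_ord// => i _.
by rewrite opprD addrACA subrr add0r -mulrBl -natrB// subSnn mul1r.
Qed.

Lemma cell_inj z x y : cell x z -> cell y z -> x = y.
Proof.
suff le x' y' i : cell x' z -> cell y' z -> (x' i <= y' i)%N.
  by move=> xz yz; apply/ffunP => i; apply/val_inj/eqP; rewrite eqn_leq !le.
move=> /(_ i)/andP[xz _] /(_ i)/andP[_ yz].
have := le_lt_trans xz yz.
by rewrite ltrD2l ltr_pM2r// ltr_nat ltnS.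
Qed.

Lemma sum_patch_cell (phi : Rn R n -> \bar R) S z x : cell x z ->
  (\sum_(y in S) (phi \_ (cell y)) z)%E = if x \in S then phi z else 0%E.
Proof.
move=> xz; have E y : y != x -> (phi \_ (cell y)) z = 0%E.
  move=> yx; rewrite patchE memNset// => yz.
  by move: yx; rewrite (cell_inj yz xz) eqxx.
case: ifPn => xS.
  rewrite (bigD1 x)//= patchE mem_set// big1 ?adde0// => y /andP[_]; exact: E.
rewrite big1// => y yS; apply: E; apply: contraNneq xS => <-; exact: yS.
Qed.

Lemma sum_patch_cell0 (phi : Rn R n -> \bar R) S z : (forall x, ~ cell x z) ->
  (\sum_(y in S) (phi \_ (cell y)) z)%E = 0%E.
Proof. by move=> Nz; rewrite big1// => y _; rewrite patchE memNset. Qed.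

Lemma measurable_patch_cell (phi : Rn R n -> \bar R) x :
  measurable_fun [set: Rn R n] phi -> measurable_fun setT (phi \_ (cell x)).
Proof.
move=> mphi; apply/(measurable_restrictT _ (measurable_cell x)).
exact: measurable_funS mphi.
Qed.

Lemma sum_integral_cell (phi : Rn R n -> \bar R) S :
  measurable_fun [set: Rn R n] phi -> (forall z, 0 <= phi z)%E ->
  (\sum_(y in S) \int[mu]_(z in cell y) phi z =
   \int[mu]_z \sum_(y in S) (phi \_ (cell y)) z)%E.
Proof.
move=> mphi phi0; under [RHS]eq_integral do rewrite -big_enum/=.
have mp y := measurable_patch_cell y mphi.
have p0 y z : [set: Rn R n] z -> (0 <= (phi \_ (cell y)) z)%E.
  by move=> _; rewrite patchE; case: ifP.
rewrite (ge0_integral_sum mu measurableT mp p0) -big_enum/=.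
by apply: eq_bigr => y _; rewrite integral_mkcond.
Qed.

Lemma sum_integral_cell_le (phi psi : Rn R n -> \bar R) S (D : set (Rn R n)) :
  measurable_fun [set: Rn R n] phi -> (forall z, 0 <= phi z)%E ->
  (forall z, 0 <= psi z)%E ->
  (forall x z, x \in S -> cell x z -> D z /\ (phi z <= psi z)%E) ->
  (\sum_(y in S) \int[mu]_(z in cell y) phi z <= \int[mu]_(z in D) psi z)%E.
Proof.
move=> mphi phi0 psi0 SD; rewrite sum_integral_cell// [leRHS]integral_mkcond.
apply: ge0_le_integralT => z.
  by apply: sume_ge0 => y _; rewrite patchE; case: ifP.
have D0 : (0 <= (psi \_ D) z)%E by rewrite patchE; case: ifP.
have [[x xz]|/forallNP Nz] := pselect (exists x, cell x z); last first.
  by rewrite sum_patch_cell0.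
rewrite (sum_patch_cell _ _ xz); case: ifP => // xS.
by have [Dz le] := SD _ _ xS xz; rewrite patchE mem_set.
Qed.

Lemma integral_le_sum_cell (phi : Rn R n -> \bar R) S (D : set (Rn R n)) :
  measurable_fun [set: Rn R n] phi -> (forall z, 0 <= phi z)%E ->
  (forall z, D z -> exists2 x, x \in S & cell x z) ->
  (\int[mu]_(z in D) phi z <= \sum_(y in S) \int[mu]_(z in cell y) phi z)%E.
Proof.
move=> mphi phi0 DS; rewrite sum_integral_cell// integral_mkcond.
apply: ge0_le_integralT => z; rewrite patchE; case: ifPn => // zD.
  have [x xS xz] := DS _ (set_mem zD).
  by rewrite (sum_patch_cell _ _ xz) xS.
by apply: sume_ge0 => y _; rewrite patchE; case: ifP.
Qed.

Definition step_fun c z : R := \sum_x c x * \1_(cell x) z.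

Lemma step_funE c x z : cell x z -> step_fun c z = c x.
Proof.
move=> xz; rewrite /step_fun (bigD1 x)//= indicE mem_set// mulr1 big1 ?addr0// => y yx.
rewrite indicE memNset ?mulr0// => yz.
by move: yx; rewrite (cell_inj yz xz) eqxx.
Qed.

Lemma step_fun0 c z : (forall x, ~ cell x z) -> step_fun c z = 0.
Proof.
by move=> Nz; rewrite /step_fun big1// => y _; rewrite indicE memNset ?mulr0.
Qed.

Lemma step_fun_ge0 c z : (forall x, 0 <= c x) -> 0 <= step_fun c z.
Proof. by move=> c0; apply: sumr_ge0 => x _; rewrite mulr_ge0// indicE. Qed.

Lemma measurable_step_fun c : measurable_fun [set: Rn R n] (step_fun c).
Proof.
apply: measurable_sum => x; apply: measurable_funM.
  exact: measurable_cst.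
exact/measurable_indicP/measurable_cell.
Qed.

Definition cell_mean (f : Rn R n -> R) x : R :=
  fine (\int[mu]_(z in cell x) `|f z|%:E) / h ^+ n.

Lemma cell_mean_ge0 f x : 0 <= cell_mean f x.
Proof.
by rewrite divr_ge0 ?exprn_ge0 ?(ltW h_gt0)// fine_ge0// integral_ge0.
Qed.

Lemma integral_cell_fin (f : Rn R n -> R) x : locally_integrable_Rn f ->
  (\int[mu]_(z in cell x) `|f z|%:E < +oo)%E.
Proof.
move=> [_ lf]; apply: le_lt_trans (lf _ (@compact_closed_box R n
  (fun i => A i + (x i)%:R * h) (fun i => A i + (x i).+1%:R * h))).
apply: ge0_le_integral_subset => //.
by move=> z xz i; have /andP[-> /ltW ->] := xz i.
Qed.

Lemma integral_cellE (f : Rn R n -> R) x : locally_integrable_Rn f ->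
  (\int[mu]_(z in cell x) `|f z|%:E)%E = (cell_mean f x * h ^+ n)%:E.
Proof.
move=> lf; have hn : h ^+ n != 0 by rewrite expf_neq0// gt_eqF.
rewrite divfK// fineK// ge0_fin_numE; first exact: integral_cell_fin.
by rewrite integral_ge0// => z _; rewrite lee_fin.
Qed.

Definition block_box (k : 'I_n -> nat) x : set (Rn R n) :=
  half_open_box (fun i => A i + (x i %/ 2 ^ k i * 2 ^ k i)%:R * h)
                (fun i => A i + ((x i %/ 2 ^ k i).+1 * 2 ^ k i)%:R * h).

Lemma cell_sub_block_box k x y : y \in dyadic_block k x -> cell y `<=` block_box k x.
Proof.
rewrite inE => /forallP yx z yz i; have /andP[yi1 yi2] := yz i.
rewrite -(eqP (yx i)); apply/andP; split.
  by apply: le_trans yi1; rewrite lerD2l ler_wpM2r ?(ltW h_gt0)// ler_nat leq_divM.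
apply: (lt_le_trans yi2); rewrite lerD2l ler_wpM2r ?(ltW h_gt0)// ler_nat.
by rewrite ltn_ceil// expn_gt0.
Qed.

Lemma block_box_cover k x z : (forall i, k i <= K)%N -> block_box k x z ->
  exists2 y, y \in dyadic_block k x & cell y z.
Proof.
move=> kK xz; pose t i := (tnth (z : n.-tuple R) i - A i) / h.
pose q i := (x i %/ 2 ^ k i)%N.
have tP i : (q i * 2 ^ k i)%:R <= t i < ((q i).+1 * 2 ^ k i)%:R.
  have /andP[h1 h2] := xz i; rewrite /t ler_pdivlMr// ltr_pdivrMr//.
  by rewrite lerBrDl ltrBlDl h1.
have t0 i : 0 <= t i by have /andP[h1 _] := tP i; exact: le_trans h1.
have trP i := truncn_itv (t0 i).
have lt1 i : (Num.trunc (t i) < (q i).+1 * 2 ^ k i)%N.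
  have /andP[h1 _] := trP i; have /andP[_ h2] := tP i.
  by rewrite -(ltr_nat R) (le_lt_trans h1).
have ge1 i : (q i * 2 ^ k i <= Num.trunc (t i))%N.
  have /andP[_ h1] := trP i; have /andP[h2 _] := tP i.
  by rewrite -ltnS -(ltr_nat R) (le_lt_trans h2).
have ltK i : (Num.trunc (t i) < 2 ^ K)%N.
  apply: (leq_trans (lt1 i)); rewrite -[X in (_ <= 2 ^ X)%N](subnK (kK i)) expnD leq_mul2r.
  by rewrite ltn_divLR ?expn_gt0// -expnD subnK// ltn_ord orbT.
exists [ffun i => Ordinal (ltK i)].
  rewrite inE; apply/forallP => i; rewrite ffunE /= eqn_leq.
  by rewrite -ltnS ltn_divLR ?expn_gt0// lt1/= leq_divRL ?expn_gt0// ge1.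
move=> i; rewrite ffunE /=; have /andP[h1 h2] := trP i.
by rewrite -lerBrDl -ltrBlDl -ler_pdivlMr// -ltr_pdivrMr// h1.
Qed.

Lemma average_le_dyadic_mean (f : Rn R n -> R) k x (a b : 'I_n -> R) :
  locally_integrable_Rn f -> (forall i, k i <= K)%N -> (forall i, a i < b i) ->
  rectangle a b `<=` block_box k x ->
  (forall i, (2 ^ k i)%:R * h <= 6 * (b i - a i)) ->
  (average (EFin \o f) (rectangle a b) <=
    (6 ^+ n * dyadic_mean k (cell_mean f) x)%:E)%E.
Proof.
move=> lf kK ab abx k6; rewrite /average lebesgue_rectangle => [|i]; last exact/ltW/ab.
set q := \prod_i _; have q0 : 0 < q by apply: prodr_gt0 => i _; rewrite subr_gt0.
rewrite inver gt_eqF// lee_pdivrMl//.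
apply: (@le_trans _ _ (\sum_(y in dyadic_block k x)
    \int[mu]_(z in cell y) `|f z|%:E)%E).
  apply: integral_le_sum_cell; [|by []|].
  - by apply: measurable_fun_abs_EFin; case: lf.
  - by move=> z /abx; exact: block_box_cover.
under eq_bigr do rewrite integral_cellE//.
rewrite sumEFin lee_fin -mulr_suml /dyadic_mean /set_mean.
rewrite card_dyadic_block//; set s := \sum_(_ in _) _.
have s0 : 0 <= s by apply: sumr_ge0 => y _; exact: cell_mean_ge0.
set p := (\prod_i 2 ^ k i)%N.
have p0 : 0 < p%:R :> R.
  by rewrite ltr0n prodn_gt0// => i; rewrite expn_gt0.
have -> : q * (6 ^+ n * (s / p%:R)) = s * (6 ^+ n * q / p%:R) by ring.
rewrite ler_wpM2l// ler_pdivlMr// /q /p natr_prod.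
have -> : 6 ^+ n = \prod_(i < n) 6 :> R by rewrite prodr_const card_ord.
have -> : h ^+ n = \prod_(i < n) h by rewrite prodr_const card_ord.
rewrite -!big_split/=; apply: ler_prod => i _.
by rewrite mulr_ge0 ?(ltW h_gt0)//= mulrC k6.
Qed.

Lemma dyadic_mean_le_strong_maximal_Rn (g : Rn R n -> \bar R) g' c (j : nat)
    (alpha : 'I_j -> nat) k x z :
  measurable_fun [set: Rn R n] g' -> (forall z, 0 <= g' z)%E -> (forall z, g' z <= `|g z|)%E ->
  (forall y, (c y * h ^+ n)%:E <= \int[mu]_(z in cell y) g' z)%E ->
  (forall i, k i <= K)%N -> (forall i, exists l, k i = alpha l) -> cell x z ->
  ((2 ^- n * dyadic_mean k c x)%:E <= strong_maximal j g z)%E.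
Proof.
move=> mg g0 gg cg kK kalpha xz.
pose side i := (2 ^ k i)%:R * h.
have side0 i : 0 < side i by rewrite mulr_gt0// ltr0n expn_gt0.
pose lo i := A i + (x i %/ 2 ^ k i * 2 ^ k i)%:R * h.
pose Q := rectangle (fun i => lo i - side i) (fun i => lo i + side i).
have boxQ : block_box k x `<=` Q.
  move=> z' xz' i; have /andP[h1 h2] := xz' i; apply/andP; split.
    by apply: lt_le_trans h1; rewrite ltrBlDr ltrDl.
  by move: h2; rewrite mulSn natrD mulrDl addrCA addrC.
have Qz : Q z by apply: boxQ; apply: (cell_sub_block_box (mem_dyadic_block k x)).
apply: (@le_trans _ _ (average g Q)); last first.
  apply: ereal_sup_ubound; exists Q => //; split => //.
  exists (fun i => lo i - side i), (fun i => lo i + side i).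
  exists (fun l => 2 * ((2 ^ alpha l)%:R * h)); split => //.
    by move=> l; rewrite !mulr_gt0// ltr0n expn_gt0.
  move=> i; have [l kl] := kalpha i; exists l; rewrite /side kl.
  by ring.
rewrite /average lebesgue_rectangle => [|i]; last first.
  by rewrite lerBlDr -addrA lerDl addr_ge0 ?ltW.
set q := \prod_i _; have qE : q = 2 ^+ n * (\prod_i 2 ^ k i)%N%:R * h ^+ n.
  have -> : 2 ^+ n = \prod_(i < n) 2 :> R by rewrite prodr_const card_ord.
  have -> : h ^+ n = \prod_(i < n) h by rewrite prodr_const card_ord.
  rewrite natr_prod -!big_split/=; apply: eq_bigr => i _; rewrite /side; ring.
have p0 : 0 < (\prod_i 2 ^ k i)%N%:R :> R.
  by rewrite ltr0n prodn_gt0// => i; rewrite expn_gt0.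
have q0 : 0 < q by rewrite qE !mulr_gt0 ?exprn_gt0.
rewrite inver gt_eqF// lee_pdivlMl//.
apply: (@le_trans _ _ (\sum_(y in dyadic_block k x)
    \int[mu]_(z in cell y) g' z)%E); last first.
  apply: sum_integral_cell_le => // y z' yx yz'; split => //.
  by apply: boxQ; apply: (cell_sub_block_box yx).
apply: (@le_trans _ _ (\sum_(y in dyadic_block k x) (c y * h ^+ n)%:E)%E); last first.
  by apply: lee_sum => y _; exact: cg.
rewrite sumEFin lee_fin -mulr_suml /dyadic_mean /set_mean card_dyadic_block// qE.
rewrite le_eqVlt; apply/orP; left; apply/eqP.
by field; rewrite !gt_eqF ?exprn_gt0.
Qed.

End grid.

Section holder.
Context {R : realType} {m : nat} (theta : 'I_m -> R).
Hypothesis theta_gt0 : forall j, 0 < theta j.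
Hypothesis theta_sum : \sum_j theta j = 1.

(* [x <= s * expR (x / s - 1)] at the weighted mean [s], then take the product. *)
Lemma weighted_AM_GM (x : 'I_m -> R) : (forall j, 0 <= x j) ->
  \prod_j x j `^ theta j <= \sum_j theta j * x j.
Proof.
move=> x0; set s := \sum_j _.
have term0 j : 0 <= theta j * x j by rewrite mulr_ge0// ltW.
have : 0 <= s by apply: sumr_ge0.
rewrite le_eqVlt => /predU1P[s0|s0].
  have [j _] : exists j : 'I_m, True.
    case: m theta theta_sum => [t|k _ _]; last by exists ord0.
    by rewrite big_ord0 => /esym/eqP; rewrite oner_eq0.
  have /eqP : theta j * x j = 0.
    apply/eqP; move/esym/eqP: s0; rewrite psumr_eq0// => /allP; apply.
    by rewrite mem_index_enum.
  rewrite mulf_eq0 (gt_eqF (theta_gt0 j))/= => /eqP xj.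
  by rewrite -s0 (bigD1 j)//= xj powR0 ?gt_eqF// mul0r.
apply: (@le_trans _ _ (\prod_j expR (theta j * (ln s + (x j / s - 1))))).
  apply: ler_prod => j _; rewrite powR_ge0/= mulrC expRM.
  apply: ge0_ler_powR; rewrite ?nnegrE ?(ltW (theta_gt0 j)) ?expR_ge0//.
  rewrite expRD lnK// -ler_pdivrMl// mulrC.
  by have := expR_ge1Dx (x j / s - 1); rewrite addrC subrK.
rewrite -expR_sum.
under eq_bigr do rewrite mulrDr mulrBr mulr1 mulrA.
rewrite big_split/= -mulr_suml theta_sum mul1r sumrB -mulr_suml theta_sum.
by rewrite divff ?gt_eqF// subrr addr0 lnK.
Qed.

Lemma prod_powR_gt0 (a : 'I_m -> R) : (forall j, 0 < a j) ->
  0 < \prod_j a j `^ theta j.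
Proof. by move=> a0; apply: prodr_gt0 => j _; rewrite powR_gt0. Qed.

Lemma integral_prod_powR_le d (T : measurableType d) (mu : {measure set T -> \bar R})
    (F : 'I_m -> T -> R) (a : 'I_m -> R) :
  (forall j, measurable_fun [set: T] (F j)) -> (forall j x, 0 <= F j x) ->
  (forall j, \int[mu]_x (F j x)%:E = (a j)%:E)%E ->
  (\int[mu]_x (\prod_j F j x `^ theta j)%:E <= (\prod_j a j `^ theta j)%:E)%E.
Proof.
move=> mF F0 Fa.
have mP : measurable_fun [set: T] (fun x => \prod_j F j x `^ theta j).
  apply: measurable_prod => j _; apply: (measurableT_comp (measurable_powR _)).
  exact: mF.
have P0 x : 0 <= \prod_j F j x `^ theta j.
  by apply: prodr_ge0 => j _; exact: powR_ge0.
have a0 j : 0 <= a j.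
  by rewrite -lee_fin -Fa integral_ge0// => x _; rewrite lee_fin.
have [[j aj]|/forallNP aN0] := pselect (exists j, a j = 0).
  have : ae_eq mu setT (EFin \o F j) (cst 0%E).
    apply/ae_eq_integral_abs => //; first exact/measurable_EFinP.
    by under eq_integral do rewrite /= ger0_norm//; rewrite Fa aj.
  move=> Fj0; rewrite (@ge0_ae_eq_integral _ _ _ mu setT _ (cst 0%E))//.
  - by rewrite integral0 lee_fin prodr_ge0// => i _; exact: powR_ge0.
  - exact/measurable_EFinP.
  - by move=> x _; rewrite lee_fin.
  - move: Fj0; apply: filterS => x Fx xT; have [Fx0] := Fx xT.
    by rewrite (bigD1 j)//= Fx0 powR0 ?gt_eqF// mul0r.
have {}a0 j : 0 < a j.
  by rewrite lt_neqAle a0 andbT eq_sym; apply/eqP; exact: aN0.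
set A := \prod_j a j `^ theta j.
have A0 : 0 < A by exact: prod_powR_gt0.
pose G x := \sum_j (A * (theta j / a j)) * F j x.
have term0 j x : 0 <= A * (theta j / a j) * F j x.
  by rewrite !mulr_ge0 ?invr_ge0 ?(ltW A0) ?(ltW (theta_gt0 j)) ?(ltW (a0 j)).
apply: (@le_trans _ _ (\int[mu]_x (G x)%:E)%E).
  apply: ge0_le_integralT => x; rewrite lee_fin//.
  have -> : \prod_j F j x `^ theta j = A * \prod_j (F j x / a j) `^ theta j.
    rewrite /A -big_split/=; apply: eq_bigr => j _.
    by rewrite -powRM ?(ltW (a0 j))// ?divr_ge0 ?(ltW (a0 j))// mulrCA divff ?mulr1// gt_eqF.
  rewrite /G; under [leRHS]eq_bigr do rewrite -mulrA -[X in A * X]mulrA.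
  rewrite -mulr_sumr ler_wpM2l ?(ltW A0)//.
  apply: le_trans (weighted_AM_GM _) _ => [j|]; first by rewrite divr_ge0 ?(ltW (a0 j)).
  by apply: ler_sum => j _; rewrite (mulrC (F j x)).
rewrite /G; under eq_integral do rewrite -sumEFin.
have mG j : measurable_fun [set: T] (fun x => A * (theta j / a j) * F j x).
  exact: measurable_funM.
rewrite ge0_integral_sum//; last 2 first.
- by move=> j; exact/measurable_EFinP.
- by move=> j x _; rewrite lee_fin.
rewrite (eq_bigr (fun j => (A * (theta j / a j) * a j)%:E)); last first.
  move=> j _; under eq_integral do rewrite EFinM.
  rewrite ge0_integralZl_EFin ?Fa//.
  - by move=> x _; rewrite lee_fin.
  - exact/measurable_EFinP.
  - by rewrite !mulr_ge0 ?invr_ge0 ?(ltW A0) ?(ltW (theta_gt0 j)) ?(ltW (a0 j)).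
rewrite /= sumEFin lee_fin.
under eq_bigr => j _ do rewrite -mulrA divfK ?gt_eqF//.
by rewrite -mulr_sumr theta_sum mulr1.
Qed.

End holder.

Lemma jensen_powR {R : realType} d (T : measurableType d)
    (mu : {measure set T -> \bar R}) (D : set T) (f : T -> R) (q a M : R) :
  measurable D -> measurable_fun [set: T] f -> 1 < q -> 0 <= a -> 0 <= M ->
  mu D = M%:E -> (\int[mu]_(x in D) `|f x|%:E)%E = (a * M)%:E ->
  ((a `^ q * M)%:E <= \int[mu]_(x in D) (`|f x| `^ q)%:E)%E.
Proof.
move=> mD mf q1 a0 M0 DM fa; have q0 : 0 < q by exact: lt_trans q1.
have q10 : 0 < q - 1 by rewrite subr_gt0.
have mf' : measurable_fun D f by exact: measurable_funS mf.
have mn : measurable_fun D (fun x => `|f x|) by exact: measurableT_comp.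
have mq : measurable_fun D (fun x => `|f x| `^ q).
  exact: (measurableT_comp (measurable_powR _)).
have young t : 0 <= t -> q * a `^ (q - 1) * t <= t `^ q + (q - 1) * a `^ q.
  move=> t0; have := @conjugate_powR R t (a `^ (q - 1)) q (q / (q - 1))
    t0 (powR_ge0 _ _) q0.
  rewrite divr_gt0// => /(_ isT); rewrite invf_div -powRrM.
  have -> : (q - 1) * (q / (q - 1)) = q by rewrite mulrCA divff ?mulr1// gt_eqF.
  have qn0 : q != 0 by rewrite gt_eqF.
  have -> : q^-1 + (q - 1) / q = 1 by field.
  move=> /(_ erefl); rewrite -(ler_pM2l q0).
  have -> : q * (t * a `^ (q - 1)) = q * a `^ (q - 1) * t by ring.
  by move=> /le_trans; apply; rewrite le_eqVlt; apply/orP; left; apply/eqP; field.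
have : (\int[mu]_(x in D) (q * a `^ (q - 1) * `|f x|)%:E <=
        \int[mu]_(x in D) (`|f x| `^ q + (q - 1) * a `^ q)%:E)%E.
  apply: ge0_le_integral => //.
  - by move=> x _; rewrite lee_fin !mulr_ge0 ?powR_ge0 ?(ltW q0).
  - by apply/measurable_EFinP; apply: measurable_funM.
  - by apply/measurable_EFinP; apply: measurable_funD.
  - by move=> x _; rewrite lee_fin young.
under eq_integral do rewrite EFinM.
rewrite ge0_integralZl_EFin ?fa//; last 2 first.
  exact/measurable_EFinP.
  by rewrite mulr_ge0 ?powR_ge0 ?(ltW q0) ?(ltW q10).
under [in leRHS]eq_integral do rewrite EFinD.
rewrite ge0_integralD//; last 2 first.
- exact/measurable_EFinP.
- by move=> x _; rewrite lee_fin mulr_ge0 ?powR_ge0 ?(ltW q0) ?(ltW q10).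
rewrite integral_cst//= DM -leeBlDr// -EFinM.
apply: le_trans; rewrite -EFinB lee_fin.
have -> : a `^ q = a `^ (q - 1) * a by rewrite powR_subr1.
by rewrite le_eqVlt; apply/orP; left; apply/eqP; ring.
Qed.

Section one_third_trick.
Context {R : realType}.
Implicit Types (N k : nat) (s : bool) (a b z : R).

Definition grid_step N : R := 3 / 2 ^+ N.

(* Two dyadic grids with top interval of length [3 * 2 ^ N], shifted by a third
   of it: at every scale the two sets of endpoints are a third of a side apart,
   so that an interval of at most that length fits in one of the grids. *)
Definition grid_origin N s : R := if s then - 2 ^+ N else - 2 ^+ N.+1.

Lemma grid_step_gt0 N : 0 < grid_step N.
Proof. by rewrite divr_gt0 ?exprn_gt0. Qed.

Lemma grid_endpoints_apart (e u v : nat) : (3 * u)%N <> (3 * v + 2 ^ e)%N.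
Proof.
move=> E; have : (3 %| 3 * v + 2 ^ e)%N by rewrite -E dvdn_mulr.
by rewrite dvdn_addr ?dvdn_mulr// Euclid_dvdX.
Qed.

Lemma one_third_trick N a b z : a < z < b -> - 2 ^+ N <= a -> b <= 2 ^+ N ->
  2 ^- N < b - a <= 2 ^+ N ->
  exists s k (x : 'I_(2 ^ (N + N))),
    let A := grid_origin N s in let h := grid_step N in
    [/\ (k <= N + N)%N, A + x%:R * h <= z < A + x.+1%:R * h,
        A + (x %/ 2 ^ k * 2 ^ k)%:R * h <= a,
        b <= A + ((x %/ 2 ^ k).+1 * 2 ^ k)%:R * h &
        (2 ^ k)%:R * h <= 6 * (b - a)].
Proof.
move=> /andP[az zb] aN bN /andP[lN Nl].
set P : R := 2 ^+ N in aN bN lN Nl *; have P0 : 0 < P by rewrite exprn_gt0.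
have [j /andP[j1 j2]] : exists j : 'I_(N + N), P^-1 * 2 ^+ j < b - a <= P^-1 * 2 ^+ j.+1.
  apply: bracket_pow2 => //; first by rewrite invr_gt0.
  by rewrite exprD mulKf// gt_eqF.
set k := j.+1 in j2; have kN : (k <= N + N)%N by exact: ltn_ord.
pose t : R := P^-1 * 2 ^+ k; have t0 : 0 < t by rewrite mulr_gt0 ?invr_gt0 ?exprn_gt0.
have LE : (2 ^ k)%:R * grid_step N = 3 * t.
  by rewrite /t /grid_step natrX -/P; ring.
have L6 : (2 ^ k)%:R * grid_step N <= 6 * (b - a).
  have tE : t = 2 * (P^-1 * 2 ^+ j) by rewrite /t /k exprS mulrCA.
  have -> : (2 ^ k)%:R * grid_step N = 6 * (P^-1 * 2 ^+ j) by rewrite LE tE; ring.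
  by rewrite ler_pM2l// ltW.
have PE : P = (2 ^ (N + N - k))%:R * t.
  by rewrite /t natrX mulrCA -exprD subnK// exprD -/P mulKf// gt_eqF.
have hE : grid_step N = 3 / P by [].
have AE s : grid_origin N s = if s then - P else - (2 * P).
  by rewrite /grid_origin exprS.
have NN : (2 ^ (N + N))%:R = P * P :> R by rewrite natrX exprD.
have {}j2 : b - a <= t by [].
clear j1; clearbody t k P.
have As s : grid_origin N s <= a.
  by rewrite AE; case: s => //; lra.
pose q s := Num.trunc ((a - grid_origin N s) / (3 * t)).
have t30 : 0 < 3 * t by rewrite mulr_gt0.
have q_ge0 s : 0 <= (a - grid_origin N s) / (3 * t).
  by rewrite divr_ge0 ?subr_ge0// ltW.
have qP s : grid_origin N s + (q s)%:R * (3 * t) <= a <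
            grid_origin N s + (q s).+1%:R * (3 * t).
  have /andP[q1 q2] := truncn_itv (q_ge0 s).
  move: q1 q2; rewrite -/(q s) ler_pdivlMr// ltr_pdivrMr//.
  by rewrite lerBrDl ltrBlDl => -> ->.
have [s bs] : exists s, b <= grid_origin N s + (q s).+1%:R * (3 * t).
  have [b0|b0] := leP b (grid_origin N false + (q false).+1%:R * (3 * t)).
    by exists false.
  have [b1|b1] := leP b (grid_origin N true + (q true).+1%:R * (3 * t)).
    by exists true.
  exfalso; have /andP[_ a0] := qP false; have /andP[_ a1] := qP true.
  apply: (@grid_endpoints_apart (N + N - k) (q false).+1 (q true).+1).
  move: a0 a1 b0 b1; rewrite !AE.
  set u := (q false).+1; set v := (q true).+1; move: PE.
  set e := (2 ^ _)%N => PE a0 a1 b0 b1.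
  clearbody u v e; clear q_ge0 qP.
  have l1 : (3 * u < (3 * v + e).+1)%N.
    rewrite -(ltr_nat R) -(natr1 (3 * v + e)%N) natrD !natrM.
    by rewrite -(ltr_pM2r t0) !mulrDl -PE; lra.
  have l2 : (3 * v + e < (3 * u).+1)%N.
    rewrite -(ltr_nat R) -(natr1 (3 * u)%N) natrD !natrM.
    by rewrite -(ltr_pM2r t0) !mulrDl -PE; lra.
  by apply/eqP; rewrite eqn_leq -ltnS l1 -ltnS l2.
exists s, k; pose h := grid_step N; have h0 : 0 < h := grid_step_gt0 N.
have /andP[qa _] := qP s.
move: qa bs; set A := grid_origin N s; set y := (z - A) / h => qa bs.
have hq (r : nat) : (r * 2 ^ k)%:R * h = r%:R * (3 * t) by rewrite natrM -mulrA LE.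
have y1 : (q s * 2 ^ k)%:R <= y.
  by rewrite ler_pdivlMr// hq lerBrDl ltW// (le_lt_trans qa).
have y2 : y < ((q s).+1 * 2 ^ k)%:R.
  by rewrite ltr_pdivrMr// hq ltrBlDl (lt_le_trans zb).
have y0 : 0 <= y by exact: le_trans y1.
have /andP[x1 x2] := truncn_itv y0; set x := Num.trunc y in x1 x2.
have xq : (x %/ 2 ^ k = q s)%N.
  apply/eqP; rewrite eqn_leq -ltnS ltn_divLR ?expn_gt0// leq_divRL ?expn_gt0//.
  rewrite -(ltr_nat R) (le_lt_trans x1 y2)/=.
  by rewrite -ltnS -(ltr_nat R) (le_lt_trans y1 x2).
have xK : (x < 2 ^ (N + N))%N.
  rewrite -(ltr_nat R) (le_lt_trans x1)// ltr_pdivrMr// NN /h hE.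
  have -> : P * P * (3 / P) = 3 * P by field; rewrite gt_eqF.
  by rewrite /A AE; case: (s); lra.
exists (Ordinal xK); split => //=.
- rewrite -lerBrDl -ltrBlDl -ler_pdivlMr// -ltr_pdivrMr//.
  by rewrite x1 x2.
- by rewrite xq hq.
- by rewrite xq hq.
Qed.

End one_third_trick.

Section maximal_ge0.
Context {R : realType} {n : nat}.
Implicit Types (g : Rn R n -> \bar R) (Q : set (Rn R n)) (z : Rn R n).

Lemma average_ge0 g Q : (0 <= average g Q)%E.
Proof. by rewrite mule_ge0 ?inve_ge0// integral_ge0// => x _; exact: abse_ge0. Qed.

Definition unit_cube z : set (Rn R n) :=
  rectangle (fun i => tnth (z : n.-tuple R) i - 1) (fun i => tnth (z : n.-tuple R) i + 1).

Lemma mem_unit_cube z : unit_cube z z.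
Proof. by move=> i; rewrite ltrBlDr !ltrDl ltr01. Qed.

Lemma strong_maximal_ge0 j g z : (0 <= strong_maximal j.+1 g z)%E.
Proof.
apply: (@le_trans _ _ (average g (unit_cube z))); first exact: average_ge0.
apply: ereal_sup_ubound; exists (unit_cube z) => //; split; last exact: mem_unit_cube.
exists (fun i => tnth (z : n.-tuple R) i - 1), (fun i => tnth (z : n.-tuple R) i + 1).
exists (fun=> 2); split => // i; exists ord0; ring.
Qed.

Lemma iterated_maximal_ge0 j g z : (0 < j)%N -> (0 <= iterated_maximal j g z)%E.
Proof. by case: j => // j _; exact: strong_maximal_ge0. Qed.

End maximal_ge0.

Section grid_comparison.
Context {R : realType} {n K : nat} (A : 'I_n -> R) (h : R).
Hypothesis h_gt0 : 0 < h.
Local Notation X := {ffun 'I_n -> 'I_(2 ^ K)}.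
Local Notation mu := (lebesgue R n).
Local Notation cell := (@cell R n K A h).
Local Notation step_fun := (@step_fun R n K A h).
Local Notation cell_mean := (@cell_mean R n K A h).
Implicit Types (x y : X) (z : Rn R n) (c v : X -> R) (f w : Rn R n -> R) (k : 'I_n -> nat).

Lemma dyadic_meanZ k (a : R) v x :
  dyadic_mean k (fun y => a * v y) x = a * dyadic_mean k v x.
Proof. by rewrite /dyadic_mean /set_mean -mulr_sumr mulrA. Qed.

Lemma directional_maximal_le_strong_maximal (g g' : Rn R n -> \bar R) (a : R) v
    (j : nat) (S : {set 'I_n}) x z :
  0 <= a -> (forall y, 0 <= v y) ->
  measurable_fun [set: Rn R n] g' -> (forall z, 0 <= g' z)%E ->
  (forall z, g' z <= `|g z|)%E ->
  (forall y, (a * v y * h ^+ n)%:E <= \int[mu]_(z in cell y) g' z)%E ->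
  (j = 0%N -> S = [set: 'I_n]%SET) -> cell x z ->
  ((2 ^- n * a * directional_maximal S v x)%:E <= strong_maximal j.+1 g z)%E.
Proof.
move=> a0 v0 mg g'0 gg cg jS xz; rewrite /directional_maximal /nested_maximal.
have [|m _ ->] := @eq_bigmax _ _ _ (0 : R) ord0 xpredT
    (fun m : 'I_K.+1 => set_mean v (dyadic_block (level_on S m) x)) isT.
  by move=> m _; exact: set_mean_ge0.
rewrite -mulrA -[_ * set_mean _ _](dyadic_meanZ (level_on S m) a v x).
have mK : (m <= K)%N by rewrite -ltnS.
case: j jS => [|j] jS.
  apply: (dyadic_mean_le_strong_maximal_Rn h_gt0 mg g'0 gg cg
    (alpha := fun=> m : nat)) => // i; first exact: level_on_le.
  by exists ord0; rewrite /level_on jS// inE.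
apply: (dyadic_mean_le_strong_maximal_Rn h_gt0 mg g'0 gg cg
    (alpha := fun l : 'I_j.+2 => if l == ord0 then 0%N else m : nat)) => // i.
  exact: level_on_le.
rewrite /level_on; case: ifP => _; first by exists ord_max.
by exists ord0.
Qed.

Lemma integral_step_cell c y : (forall x, 0 <= c x) ->
  (\int[mu]_(z in cell y) (step_fun c z)%:E = (c y * h ^+ n)%:E)%E.
Proof.
move=> c0; rewrite (eq_integral (fun=> (c y)%:E)); last first.
  by move=> z /[1!inE] yz; rewrite (step_funE h_gt0 _ yz).
by rewrite integral_cst//= ?lebesgue_cell//; exact: measurable_cell.
Qed.

Lemma iterated_maximal_lower w j x z : weight w -> cell x z ->
  (((2 ^- n) ^+ j.+1 *
      iter j sup_directional_maximal (cubic_maximal (cell_mean w)) x)%:E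
    <= iterated_maximal j.+1 (EFin \o w) z)%E.
Proof.
move=> [w0 lw].
have a0 i : 0 <= (2 ^- n) ^+ i :> R by rewrite exprn_ge0// invr_ge0 exprn_ge0.
elim: j x z => [|j IH] x z xz.
  have mw : measurable_fun [set: Rn R n] (EFin \o w).
    by apply/measurable_EFinP; case: lw.
  have w0' z' : (0 <= (EFin \o w) z')%E by exact: w0.
  have ww z' : ((EFin \o w) z' <= `|(EFin \o w) z'|)%E by exact: lee_abs.
  have wm y : ((1 * cell_mean w y * h ^+ n)%:E <=
      \int[mu]_(z' in cell y) (EFin \o w) z')%E.
    rewrite mul1r -integral_cellE//.
    by apply: ge0_le_integral_subset => // z' _; rewrite ger0_norm.
  have H := directional_maximal_le_strong_maximal (j := 0) ler01
    (cell_mean_ge0 A h_gt0 w) mw w0' ww wm (fun=> erefl) xz.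
  rewrite mulr1 in H; rewrite expr1; exact: H.
set V := iter j sup_directional_maximal (cubic_maximal (cell_mean w)) in IH *.
have V0 y : 0 <= V y.
  by apply: iter_sup_directional_ge0 => y'; exact: cubic_maximal_ge0.
have c0 y : 0 <= (2 ^- n) ^+ j.+1 * V y by rewrite mulr_ge0.
rewrite [iterated_maximal _ _]/= [iter _ _ _]/=.
have [|S _ ES] := @eq_bigmax _ _ _ (0 : R) finset.set0 xpredT
    (fun S : {set 'I_n} => directional_maximal S V x) isT.
  by move=> S _; exact: nested_maximal_ge0.
rewrite /sup_directional_maximal ES exprS.
set c := fun y => (2 ^- n) ^+ j.+1 * V y in c0.
have mc : measurable_fun [set: Rn R n] (EFin \o step_fun c).
  by apply/measurable_EFinP; exact: measurable_step_fun.
have sc0 z' : (0 <= (EFin \o step_fun c) z')%E.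
  by rewrite lee_fin step_fun_ge0.
have scW z' : ((EFin \o step_fun c) z' <= `|iterated_maximal j.+1 (EFin \o w) z'|)%E.
  rewrite [leLHS]/=; have [[y yz]|/forallNP Nz] := pselect (exists y, cell y z').
    by rewrite (step_funE h_gt0 _ yz); apply: le_trans (IH _ _ yz) (lee_abs _).
  by rewrite step_fun0// abse_ge0.
have scm y : ((c y * h ^+ n)%:E <= \int[mu]_(z' in cell y) (EFin \o step_fun c) z')%E.
  by rewrite integral_step_cell.
exact: (directional_maximal_le_strong_maximal (a0 j.+1) V0 mc sc0 scW scm _ xz).
Qed.

Lemma integral_step_powR w c (q : R) : weight w -> 0 < q -> (forall x, 0 <= c x) ->
  (\int[mu]_z (step_fun c z `^ q * w z)%:E =
   (\sum_x c x `^ q * cell_mean w x * h ^+ n)%:E)%E.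
Proof.
move=> [w0 lw] q0 c0.
have mphi : measurable_fun [set: Rn R n] (fun z => (step_fun c z `^ q * w z)%:E).
  apply/measurable_EFinP; apply: measurable_funM; last by case: lw.
  exact/measurable_fun_powR/measurable_step_fun.
transitivity (\int[mu]_z (\sum_(x in [set: X]%SET)
    ((fun z => (step_fun c z `^ q * w z)%:E) \_ (cell x)) z))%E.
  apply: eq_integral => z _.
  have [[y yz]|/forallNP Nz] := pselect (exists y, cell y z).
    by rewrite (sum_patch_cell h_gt0 _ _ yz) inE.
  by rewrite sum_patch_cell0// step_fun0// powR0 ?gt_eqF// mul0r.
rewrite -sum_integral_cell//; last first.
  by move=> z; rewrite lee_fin mulr_ge0// powR_ge0.
rewrite -sumEFin; apply: eq_big => [x|x _]; first by rewrite inE.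
rewrite (eq_integral (fun z => (c x `^ q)%:E * `|w z|%:E)%E); last first.
  by move=> z /[1!inE] xz; rewrite (step_funE h_gt0 _ xz) -EFinM ger0_norm.
have mw : measurable_fun (cell x) (fun z => `|w z|%:E).
  by apply: measurable_fun_abs_EFin; case: lw => mw _; exact: measurable_funTS.
have nw z : cell x z -> (0 <= `|w z|%:E)%E by move=> _; exact: normr_ge0.
rewrite (ge0_integralZl_EFin mu (measurable_cell A h x) nw mw (powR_ge0 _ _)).
by rewrite integral_cellE// -EFinM mulrA.
Qed.

Lemma grid_strong_maximal w f (q : R) : (0 < n)%N -> 1 < q -> weight w ->
  locally_integrable_Rn f ->
  ((\sum_x dyadic_strong_maximal (cell_mean f) x `^ q * cell_mean w x * h ^+ n)%:E <=
   (@dyadic_const R n q * (2 ^+ n) ^+ n)%:E *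
     \int[mu]_z ((`|f z| `^ q)%:E * iterated_maximal n (EFin \o w) z))%E.
Proof.
move=> n0 q1 ww lf; have q0 : 0 < q by exact: lt_trans q1.
set V := iter n.-1 sup_directional_maximal (cubic_maximal (cell_mean w)).
have V0 y : 0 <= V y.
  by apply: iter_sup_directional_ge0 => y'; exact: cubic_maximal_ge0.
have hn0 : 0 <= h ^+ n by rewrite exprn_ge0// ltW.
have k0 : 0 < (2 ^+ n) ^+ n :> R by rewrite !exprn_gt0.
have D0 : 0 <= @dyadic_const R n q.
  have i0 := ltW (interpolation_const_gt0 q1).
  by rewrite /dyadic_const mulr_ge0// exprn_ge0// mulr_ge0.
pose Wz z := iterated_maximal n (EFin \o w) z.
have VW x z : cell x z -> ((((2 ^+ n) ^+ n)^-1 * V x)%:E <= Wz z)%E.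
  move=> xz; have := @iterated_maximal_lower w n.-1 x z ww xz.
  by rewrite prednK// exprVn.
have W0 z : (0 <= Wz z)%E.
  exact: iterated_maximal_ge0.
pose c x := ((2 ^+ n) ^+ n)^-1 * V x.
have c0 x : 0 <= c x by rewrite mulr_ge0// invr_ge0 ltW.
have key : ((((2 ^+ n) ^+ n)^-1 * \sum_x cell_mean f x `^ q * V x * h ^+ n)%:E <=
    \int[mu]_z ((`|f z| `^ q)%:E * Wz z))%E.
  have mq : measurable_fun [set: Rn R n] (fun z => `|f z| `^ q).
    by apply: measurable_fun_powR; apply: measurable_fun_abs; case: lf.
  apply: (@le_trans _ _ (\sum_(x in [set: X]%SET)
      \int[mu]_(z in cell x) (`|f z| `^ q * step_fun c z)%:E)%E); last first.
    apply: (sum_integral_cell_le h_gt0).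
    - apply/measurable_EFinP; apply: measurable_funM; first exact: mq.
      exact: measurable_step_fun.
    - by move=> z; rewrite lee_fin mulr_ge0 ?powR_ge0 ?step_fun_ge0.
    - by move=> z; rewrite mule_ge0// lee_fin powR_ge0.
    - move=> x z _ xz; split => //.
      rewrite (step_funE h_gt0 _ xz) EFinM lee_wpmul2l ?lee_fin ?powR_ge0//.
      exact: VW.
  rewrite mulr_sumr -sumEFin [leRHS](eq_bigl xpredT); last by move=> x; rewrite inE.
  apply: lee_sum => x _.
  rewrite (eq_integral (fun z => (c x)%:E * (`|f z| `^ q)%:E)%E); last first.
    by move=> z /[1!inE] xz; rewrite (step_funE h_gt0 _ xz) mulrC EFinM.
  have mqx : measurable_fun (cell x) (fun z => (`|f z| `^ q)%:E).
    by apply/measurable_EFinP; exact: measurable_funTS.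
  have q_ge0 z : cell x z -> (0 <= (`|f z| `^ q)%:E)%E by move=> _; exact: powR_ge0.
  rewrite (ge0_integralZl_EFin mu (measurable_cell A h x) q_ge0 mqx (c0 x)).
  apply: (@le_trans _ _ ((c x)%:E * (cell_mean f x `^ q * h ^+ n)%:E)%E).
    by rewrite -EFinM lee_fin /c le_eqVlt; apply/orP; left; apply/eqP; ring.
  have cx0 : (0 <= (c x)%:E)%E by exact: c0.
  apply: (lee_wpmul2l cx0); have mf : measurable_fun [set: Rn R n] f by case: lf.
  exact: (jensen_powR (measurable_cell A h x) mf q1 (cell_mean_ge0 A h_gt0 f x) hn0
    (lebesgue_cell A h_gt0 x) (integral_cellE A h_gt0 x lf)).
have Dk0 : (0 <= (@dyadic_const R n q * (2 ^+ n) ^+ n)%:E)%E.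
  by rewrite lee_fin mulr_ge0// ltW.
apply: le_trans (lee_wpmul2l Dk0 key).
rewrite -EFinM lee_fin -mulrA mulVKf ?gt_eqF// -!mulr_suml mulrA ler_wpM2r//.
by apply: dyadic_strong_maximal_strong => // x; exact: cell_mean_ge0.
Qed.

End grid_comparison.

Section extended_reals.
Context {R : realType}.
Local Open Scope ereal_scope.

Lemma lee_prod (I : Type) (r : seq I) (F G : I -> \bar R) :
  (forall i, 0 <= F i) -> (forall i, F i <= G i) ->
  \prod_(i <- r) F i <= \prod_(i <- r) G i.
Proof.
move=> F0 FG; elim: r => [|i r IH]; first by rewrite !big_nil.
by rewrite !big_cons lee_pmul// prode_ge0.
Qed.

Lemma lee_poweR (p : R) (x y : \bar R) : (0 <= p)%R -> 0 <= x -> x <= y ->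
  x `^ p <= y `^ p.
Proof.
move=> p0 x0 xy; apply: gt0_ler_poweR => //; rewrite in_itv/= leey andbT//.
exact: le_trans xy.
Qed.

Lemma limn_einf_ge (u : (\bar R)^nat) (a : \bar R) (N : nat) :
  (forall k, (N <= k)%N -> a <= u k) -> a <= limn_einf u.
Proof.
move=> au; rewrite limn_einf_lim (cvg_lim _ (@cvg_einfs_sup _ u))//.
apply: (@le_trans _ _ (einfs u N)); last by apply: ereal_sup_ubound; exists N.
by apply: le_ereal_inf_tmp => _ [k Nk <-]; exact: au.
Qed.

Lemma limn_einf_le (u : (\bar R)^nat) (a : \bar R) :
  (forall k, u k <= a) -> limn_einf u <= a.
Proof.
move=> ua; rewrite limn_einf_lim (cvg_lim _ (@cvg_einfs_sup _ u))//.
apply: ge_ereal_sup => _ [N _ <-]; apply: (@le_trans _ _ (u N)) => //.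
by apply: ereal_inf_lbound; exists N => //=.
Qed.

Lemma ereal_sup_poweR_le (S : set (\bar R)) (p c : R) (L : \bar R) :
  (0 < p)%R -> (0 <= c)%R -> 0 <= L -> S !=set0 -> (forall a, S a -> 0 <= a) ->
  (forall a, S a -> a `^ p * c%:E <= L) -> ereal_sup S `^ p * c%:E <= L.
Proof.
move=> p0 c0 L0 [a1 Sa1] S0 SL.
have [->|cn0] := eqVneq c 0%R; first by rewrite mule0.
have {}c0 : (0 < c)%R by rewrite lt_neqAle eq_sym cn0.
case: L L0 SL => [l| |] L0 SL; [|by rewrite leey|by []].
have aL a : S a -> a <= ((l / c) `^ p^-1)%:E.
  move=> Sa; have := SL a Sa; rewrite -lee_pdivlMr// => /(@lee_poweR p^-1).
  rewrite invr_ge0 (ltW p0) poweR_ge0 => /(_ isT isT).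
  by rewrite -poweRrM divff ?gt_eqF// poweRe1 ?S0// -EFinM poweR_EFin.
rewrite -lee_pdivlMr//; apply: (@le_trans _ _ (((l / c) `^ p^-1)%:E `^ p)).
  apply: lee_poweR; first exact: ltW.
    by apply: le_trans (S0 _ Sa1) _; exact: ereal_sup_ubound.
  by apply: ge_ereal_sup => a; exact: aL.
rewrite poweR_EFin -powRrM mulVf ?gt_eqF// powRr1 ?EFinM//.
by rewrite divr_ge0 ?(ltW c0).
Qed.

End extended_reals.

Section multilinear.
Context {R : realType} {m n : nat} (ps : 'I_m -> R) (p : R).
Hypothesis n_gt0 : (0 < n)%N.
Hypothesis ps_gt1 : forall j, 1 < ps j.
Hypothesis p_gt0 : 0 < p.
Hypothesis theta_sum : \sum_j p / ps j = 1.
Variables (w f : 'I_m -> Rn R n -> R).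
Hypothesis w_weight : forall j, weight (w j).
Hypothesis f_loc : forall j, locally_integrable_Rn (f j).
Local Notation mu := (lebesgue R n).

Let ps_gt0 j : 0 < ps j.
Proof. by rewrite (lt_trans _ (ps_gt1 j)). Qed.

Let theta_gt0 j : 0 < p / ps j.
Proof. by rewrite divr_gt0. Qed.

Definition weight_product (y : Rn R n) : R := \prod_(j < m) (w j y `^ (p / ps j)).

Lemma weight_product_ge0 y : 0 <= weight_product y.
Proof. by apply: prodr_ge0 => j _; exact: powR_ge0. Qed.

Definition grid_origins N (s : {ffun 'I_n -> bool}) (i : 'I_n) : R :=
  grid_origin N (s i).

Definition grid_strong N s j : {ffun 'I_n -> 'I_(2 ^ (N + N))} -> R :=
  fun x => 6 ^+ n *
    dyadic_strong_maximal (cell_mean (grid_origins N s) (grid_step N) (f j)) x.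
Arguments grid_strong : clear implicits.

Definition grid_factor N s j (z : Rn R n) : R :=
  step_fun (grid_origins N s) (grid_step N) (grid_strong N s j) z `^ ps j * w j z.

Definition grid_majorant N (z : Rn R n) : R :=
  \sum_(s : {ffun 'I_n -> bool}) \prod_j grid_factor N s j z `^ (p / ps j).

Lemma grid_strong_ge0 N s j x : 0 <= grid_strong N s j x.
Proof. by rewrite mulr_ge0 ?exprn_ge0 ?dyadic_strong_maximal_ge0. Qed.

Lemma grid_factor_ge0 N s j z : 0 <= grid_factor N s j z.
Proof. by rewrite mulr_ge0 ?powR_ge0//; case: (w_weight j). Qed.

Lemma measurable_grid_factor N s j :
  measurable_fun [set: Rn R n] (grid_factor N s j).
Proof.
apply: measurable_funM; last by case: (w_weight j) => _ [].
exact/measurable_fun_powR/measurable_step_fun.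
Qed.

Lemma measurable_grid_majorant N :
  measurable_fun [set: Rn R n] (grid_majorant N).
Proof.
apply: measurable_sum => s; apply: measurable_prod => j _.
exact/measurable_fun_powR/measurable_grid_factor.
Qed.

Lemma rectangle_in_grid (a b : 'I_n -> R) (z : Rn R n) :
  rectangle a b z -> exists N0 : nat, forall N, (N0 <= N)%N ->
  exists (s : {ffun 'I_n -> bool}) (k : 'I_n -> nat)
    (x : {ffun 'I_n -> 'I_(2 ^ (N + N))}),
    [/\ forall i, (k i <= N + N)%N, cell (grid_origins N s) (grid_step N) x z,
      rectangle a b `<=` block_box (grid_origins N s) (grid_step N) k x &
      forall i, (2 ^ k i)%:R * grid_step N <= 6 * (b i - a i)].
Proof.
move=> abz; pose M i := `|a i| + `|b i| + (b i - a i) + (b i - a i)^-1.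
have ab i : 0 < b i - a i.
  by have /andP[az zb] := abz i; rewrite subr_gt0 (lt_trans az).
have M0 i : 0 <= M i.
  by apply: addr_ge0; [apply: addr_ge0; [exact: addr_ge0|exact: ltW]|rewrite invr_ge0 ltW].
exists (Num.trunc (\sum_i M i)).+1 => N MN.
have MP i : M i < 2 ^+ N.
  apply: (@le_lt_trans _ _ (\sum_i M i)).
    by rewrite (bigD1 i)//= lerDl sumr_ge0.
  apply: (lt_le_trans (truncnS_gt _)).
  by rewrite -natrX ler_nat (leq_trans MN)// ltnW// ltn_expl.
have P0 : 0 < 2 ^+ N :> R by rewrite exprn_gt0.
have one i : exists skx : bool * nat * 'I_(2 ^ (N + N)),
    let A := grid_origin N skx.1.1 in let h := grid_step N in
    let k := skx.1.2 in let x := skx.2 in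
    [/\ (k <= N + N)%N, A + x%:R * h <= tnth (z : n.-tuple R) i < A + x.+1%:R * h,
        A + (x %/ 2 ^ k * 2 ^ k)%:R * h <= a i,
        b i <= A + ((x %/ 2 ^ k).+1 * 2 ^ k)%:R * h &
        (2 ^ k)%:R * h <= 6 * (b i - a i)].
  have abi := ltW (ab i); have iv : 0 <= (b i - a i)^-1 by rewrite invr_ge0.
  have MPi := MP i; rewrite /M in MPi.
  have na := normr_ge0 (a i); have nb := normr_ge0 (b i).
  have [|||s [k [x H]]] := @one_third_trick R N (a i) (b i) _ (abz i).
  - have := ler_norm (- a i); rewrite normrN; lra.
  - have := ler_norm (b i); lra.
  - rewrite invf_plt ?posrE//; apply/andP; split; lra.
  by exists (s, k, x).
have [skx skxP] := choice one.
exists [ffun i => (skx i).1.1], (fun i => (skx i).1.2), [ffun i => (skx i).2].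
split.
- by move=> i; have [] := skxP i.
- by move=> i; rewrite /grid_origins !ffunE; have [] := skxP i.
- move=> y aby i; rewrite /grid_origins !ffunE; have [_ _ l1 l2 _] := skxP i.
  have /andP[y1 y2] := aby i.
  by rewrite (le_trans l1 (ltW y1)) (lt_le_trans y2 l2).
- by move=> i; have [] := skxP i.
Qed.

Lemma rectangle_le_grid_majorant (a b : 'I_n -> R) (z : Rn R n) :
  rectangle a b z -> exists N0 : nat, forall N, (N0 <= N)%N ->
  ((\prod_j average (EFin \o f j) (rectangle a b)) `^ p * (weight_product z)%:E <=
   (grid_majorant N z)%:E)%E.
Proof.
move=> abz; have [N0 HN0] := rectangle_in_grid abz; exists N0 => N /HN0.
move=> [s [k [x [kK xz abx k6]]]]; have h0 := @grid_step_gt0 R N.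
have ab i : a i < b i by have /andP[az zb] := abz i; rewrite (lt_trans az).
have avg j : (average (EFin \o f j) (rectangle a b) <= (grid_strong N s j x)%:E)%E.
  apply: le_trans (average_le_dyadic_mean h0 (f_loc j) kK ab abx k6) _.
  rewrite lee_fin ler_wpM2l ?exprn_ge0//.
  exact: dyadic_mean_le_strong_maximal.
apply: (@le_trans _ _ ((\prod_j (grid_strong N s j x)%:E) `^ p *
    (weight_product z)%:E)%E).
  rewrite lee_wpmul2r ?lee_fin ?weight_product_ge0//.
  apply: lee_poweR; first exact: ltW.
    by apply: prode_ge0 => j _; exact: average_ge0.
  by apply: lee_prod => j //; exact: average_ge0.
rewrite prodEFin poweR_EFin -EFinM lee_fin.
have -> : (\prod_j grid_strong N s j x) `^ p * weight_product z =
    \prod_j grid_factor N s j z `^ (p / ps j).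
  have prodX (r : seq 'I_m) : (\prod_(j <- r) grid_strong N s j x) `^ p =
      \prod_(j <- r) grid_strong N s j x `^ p.
    elim: r => [|j r IH]; first by rewrite !big_nil powR1.
    rewrite !big_cons powRM ?IH ?grid_strong_ge0// prodr_ge0// => i _.
    exact: grid_strong_ge0.
  rewrite prodX /weight_product -big_split/=; apply: eq_bigr => j _.
  rewrite /grid_factor (step_funE h0 _ xz) powRM ?powR_ge0//; last first.
    by case: (w_weight j).
  by rewrite -powRrM mulrCA divff ?mulr1// gt_eqF.
rewrite /grid_majorant (bigD1 s)//= lerDl sumr_ge0// => s' _.
by apply: prodr_ge0 => j _; exact: powR_ge0.
Qed.

Definition component_const j : R :=
  (6 ^+ n) `^ ps j * (@dyadic_const R n (ps j) * (2 ^+ n) ^+ n).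

Local Notation W j := (iterated_maximal n (EFin \o w j)).

Lemma component_const_gt0 j : 0 < component_const j.
Proof.
have i0 := interpolation_const_gt0 (ps_gt1 j).
have c0 : 0 < #|{set 'I_n}|%:R :> R by rewrite ltr0n; apply/card_gt0P; exists finset.set0.
have D0 : 0 < @dyadic_const R n (ps j).
  by apply: mulr_gt0 => //; apply: exprn_gt0; exact: mulr_gt0.
apply: mulr_gt0; first by apply: powR_gt0; exact: exprn_gt0.
by apply: mulr_gt0 => //; do 2!apply: exprn_gt0.
Qed.

Lemma integral_grid_factor N s j : exists2 a : R,
  (\int[mu]_z (grid_factor N s j z)%:E = a%:E)%E &
  (0 <= a) /\ (a%:E <= (component_const j)%:E *
    \int[mu]_z ((`|f j z| `^ ps j)%:E * W j z))%E.
Proof.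
have h0 := @grid_step_gt0 R N.
pose cm := @cell_mean R n (N + N) (grid_origins N s) (grid_step N) (w j).
exists (\sum_x grid_strong N s j x `^ ps j * cm x * grid_step N ^+ n).
  rewrite /grid_factor integral_step_powR// => x; exact: grid_strong_ge0.
split.
  apply: sumr_ge0 => x _; apply: mulr_ge0; last by rewrite exprn_ge0// ltW.
  by apply: mulr_ge0; [exact: powR_ge0|exact: cell_mean_ge0].
have := @grid_strong_maximal R n (N + N) (grid_origins N s) (grid_step N) h0
  (w j) (f j) (ps j) n_gt0 (ps_gt1 j) (w_weight j) (f_loc j).
move=> /(lee_wpmul2l (_ : 0 <= ((6 ^+ n) `^ ps j)%:E)%E).
rewrite lee_fin powR_ge0 => /(_ isT).
rewrite muleA -!EFinM; apply: le_trans.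
rewrite lee_fin mulr_sumr ler_sum// => x _.
rewrite powRM ?exprn_ge0 ?dyadic_strong_maximal_ge0//.
by rewrite -!mulrA.
Qed.

Lemma integral_grid_majorant N :
  (\int[mu]_z (grid_majorant N z)%:E <=
   (#|{ffun 'I_n -> bool}|%:R * \prod_j component_const j `^ (p / ps j))%:E *
     \prod_(j < m) (weighted_Lnorm (ps j) (W j) (f j) `^ p))%E.
Proof.
under eq_integral do rewrite -sumEFin.
have mP s : measurable_fun [set: Rn R n]
    (fun z => (\prod_j grid_factor N s j z `^ (p / ps j))%:E).
  apply/measurable_EFinP; apply: measurable_prod => j _.
  exact/measurable_fun_powR/measurable_grid_factor.
have P0 s z : [set: Rn R n] z ->
    (0 <= (\prod_j grid_factor N s j z `^ (p / ps j))%:E)%E.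
  by move=> _; rewrite lee_fin prodr_ge0// => j _; exact: powR_ge0.
rewrite (ge0_integral_sum mu measurableT mP P0).
set B := (\prod_(j < m) _)%E.
have -> : ((#|{ffun 'I_n -> bool}|%:R * \prod_j component_const j `^ (p / ps j))%:E * B =
   \sum_(s : {ffun 'I_n -> bool}) (\prod_j component_const j `^ (p / ps j))%:E * B)%E.
  by rewrite sumr_const EFinM -muleA mule_natl.
apply: lee_sum => s _.
have [a aE aP] : exists2 a : 'I_m -> R,
    (forall j, \int[mu]_z (grid_factor N s j z)%:E = (a j)%:E)%E &
    forall j, 0 <= a j /\ ((a j)%:E <= (component_const j)%:E *
      \int[mu]_z ((`|f j z| `^ ps j)%:E * W j z))%E.
  have /choice[a aP] : forall j, exists a : R,
    ((\int[mu]_z (grid_factor N s j z)%:E = a%:E)%E /\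
     (0 <= a) /\ (a%:E <= (component_const j)%:E *
    \int[mu]_z ((`|f j z| `^ ps j)%:E * W j z))%E).
    by move=> j; have [a ? ?] := integral_grid_factor N s j; exists a.
  by exists a => j; have [] := aP j.
apply: le_trans (integral_prod_powR_le theta_gt0 theta_sum
  (measurable_grid_factor N s) (grid_factor_ge0 N s) aE) _.
rewrite -prodEFin -prodEFin -big_split/=.
under eq_bigr do rewrite -poweR_EFin.
apply: lee_prod => j; first exact: poweR_ge0.
have [aj0 aj] := aP j.
apply: le_trans (lee_poweR (ltW (theta_gt0 j)) _ aj) _; first by rewrite lee_fin.
rewrite poweRM ?lee_fin ?(ltW (component_const_gt0 j))//; last first.
  apply: integral_ge0 => z _; rewrite mule_ge0 ?lee_fin ?powR_ge0//.
  exact: iterated_maximal_ge0.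
by rewrite poweR_EFin /weighted_Lnorm -poweRrM (mulrC p).
Qed.

Lemma multilinear_strong_maximal_le :
  (\int[mu]_y (multilinear_strong_maximal f y `^ p * (weight_product y)%:E) <=
   (#|{ffun 'I_n -> bool}|%:R * \prod_j component_const j `^ (p / ps j))%:E *
     \prod_(j < m) (weighted_Lnorm (ps j) (W j) (f j) `^ p))%E.
Proof.
have G0 N z : 0 <= grid_majorant N z.
  by apply: sumr_ge0 => s _; apply: prodr_ge0 => j _; exact: powR_ge0.
apply: (@le_trans _ _ (\int[mu]_y limn_einf (fun N => (grid_majorant N y)%:E))%E).
  apply: ge0_le_integralT => y.
    by rewrite mule_ge0 ?poweR_ge0 ?lee_fin ?weight_product_ge0.
  apply: ereal_sup_poweR_le => //; first exact: weight_product_ge0.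
  - by apply: (@limn_einf_ge _ _ _ 0) => N _; rewrite lee_fin.
  - exists (\prod_(j < m) average (EFin \o f j) (unit_cube y))%E.
    exists (unit_cube y) => //; split; last exact: mem_unit_cube.
    exists (fun i => tnth (y : n.-tuple R) i - 1), (fun i => tnth (y : n.-tuple R) i + 1).
    by split => // i; lra.
  - by move=> _ [Q _ <-]; apply: prode_ge0 => j _; exact: average_ge0.
  - move=> _ [_ [[a [b [ab ->]]] /= aby] <-].
    have [N0 HN0] := rectangle_le_grid_majorant aby.
    exact: (@limn_einf_ge _ _ _ N0).
apply: le_trans (fatou mu measurableT _ _) _.
- by move=> N; apply/measurable_EFinP; exact: measurable_grid_majorant.
- by move=> N y _; rewrite lee_fin.
by apply: limn_einf_le => N; exact: integral_grid_majorant.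
Qed.

End multilinear.

Theorem corollary1p3 (R : realType) (m n : nat) (ps : 'I_m -> R) (p : R)
    (m_gt0 : (0 < m)%N) (n_gt0 : (0 < n)%N)
    (ps_gt1 : forall j, 1 < ps j)
    (pE : p^-1 = \sum_(j < m) (ps j)^-1) :
  exists C : R, 0 < C /\
    forall w f : 'I_m -> Rn R n -> R,
      (forall j, weight (w j)) ->
      (forall j, locally_integrable_Rn (f j)) ->
      let nu := fun y => \prod_(j < m) (w j y `^ (p / ps j)) in
      let W := fun j => iterated_maximal n (EFin \o w j) in
      (\int[lebesgue R n]_y
          (multilinear_strong_maximal f y `^ p * (nu y)%:E)
       <= C%:E * \prod_(j < m) (weighted_Lnorm (ps j) (W j) (f j) `^ p))%E.
Proof.
have ps_gt0 j : 0 < ps j by rewrite (lt_trans _ (ps_gt1 j)).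
have p_gt0 : 0 < p.
  rewrite -invr_gt0 pE (bigD1 (Ordinal m_gt0))//= ltr_pwDl ?invr_gt0//.
  by apply: sumr_ge0 => j _; rewrite invr_ge0 ltW.
have theta_sum : \sum_j p / ps j = 1.
  by rewrite -mulr_sumr -pE divff// gt_eqF.
exists (#|{ffun 'I_n -> bool}|%:R * \prod_j @component_const R m n ps j `^ (p / ps j)).
split.
  rewrite mulr_gt0//.
    by rewrite ltr0n; apply/card_gt0P; exists [ffun=> false].
  by apply: prodr_gt0 => j _; rewrite powR_gt0// component_const_gt0.
move=> w f ww ff; exact: multilinear_strong_maximal_le.
Qed.
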